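(* Let $L$ be a field of characteristic $0$, and let $L_{\mathbf r}((T^{-1}))$ have the usual addition, the standard degree map $\deg_r$ and the topology it induces. Let $\eta_i:L\to L$, $i\in\mathbb{Z}_{\le 0}$, be additive maps, not all zero. Then the following are equivalent. (1) There exists a unique multiplication $\tilde\eta$ on $L_{\mathbf r}((T^{-1}))$ such that $L_{\mathbf r}((T^{-1};\tilde\eta))$ is a right deformed Laurent series ring with the standard degree map, satisfying $$a\cdot T=Ta+\sum_{i=0}^{-\infty}T^i\eta_i(a),\qquad a\in L.$$ (2) For all $i\le 0$ and $a,b\in L$, $$\eta_i(ab)=a\,\eta_i(b)+\eta_i(a)\,b+\sum_{k>0}\ \sum_{\substack{l,j_1,\dots,j_k\in\mathbb{Z}_{\le 0}\\ j_1+\cdots+j_k-k+l=i}}\binom{l}{k}\,\eta_{j_1}\cdots\eta_{j_k}(a)\,\eta_l(b).$$ If (2) holds, then $$\Big(\sum_{i\le m}T^ia_i\Big)\Big(\sum_{j\le n}T^jb_j\Big)=\sum_{i\le m,\,j\le n}T^ia_i\cdot T^jb_j,$$ where $$T^ia_i\cdot T^jb_j=T^{i+j}a_ib_j+\sum_{k>0}\ \sum_{(j_1,\dots,j_k)\in(\mathbb{Z}_{\le 0})^k}\binom{j}{k}\,T^{j_1+\cdots+j_k-k+i+j}\,\eta_{j_1}\cdots\eta_{j_k}(a_i)\,b_j.$$ Moreover, $L_{\mathbf r}((T^{-1};\tilde\eta))$ is then a topological division ring which is complete with respect to the topology induced by $\deg_r$, and its center is the field $K=\bigcap_{i\le 0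}\mathrm{Ker}(\eta_i)$.
   Context: For a field $L$, $L_{\mathbf r}((T^{-1}))=\{\sum_{i\le k}T^ia_i : a_i\in L,\ k\in\mathbb{Z}\}$ is the right $L$-vector space of (inverse) formal Laurent series. The standard degree map is $\deg_r:L_{\mathbf r}((T^{-1}))\to\mathbb{Z}\cup\{-\infty\}$, $\deg_r 0=-\infty$, $\deg_r(\sum_{i\le k}T^ia_i)=k$ if $a_k\ne 0$. The topology is induced by the metric $d(f,g)=e^{\deg_r(f-g)}$. A right deformed Laurent series ring (with the standard degree map) $L_{\mathbf r}((T^{-1};\tilde\eta))$ is $L_{\mathbf r}((T^{-1}))$ with its usual addition, standard degree map and topology, together with a multiplication $\tilde\eta:(f,g)\mapsto f\cdot g$ such that: (i) the multiplication is associative, distributive over addition, and continuous; (ii) $\big(\sum_{i\le k}T^ia_i\big)\cdot b=\sum_{i\le k}T^i(a_ib)$ for $b\in L$; (iii) $T^i\cdot T^j=T^{i+j}$ for $i,j\in\mathbb{Z}$ (with $T^0=1$); (iv) $\deg_r(f\cdot g)=\deg_r f+\deg_r g$ for all $f,g$. For an integer $a$ and $k\ge 0$, $\binom{a}{k}=a(a-1)\cdots(a-k+1)/k!$, with $\binom a0=1$. The notation $\eta_{j_1}\cdots\eta_{j_k}$ means composition of maps. *)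

(* Defs.v *)
From HB Require Import structures.
From mathcomp Require Import all_boot all_order all_algebra finmap.
From mathcomp Require Import all_classical all_reals all_analysis.
From mathcomp Require Import Rstruct.
From mathcomp.analysis.showcase Require summability.

Set Implicit Arguments.
Unset Strict Implicit.
Unset Printing Implicit Defensive.

Import Order.TTheory GRing.Theory Num.Theory.

Local Open Scope classical_set_scope.
Local Open Scope ring_scope.

Definition below (k : int) := {i : int | i <= k}.
Definition nonpos_int := below 0.

(* [f i] is the right coefficient of [T^i]: [f = \sum_i T^i (f i)]. *)
Record laurent (L : fieldType) := Laurent {
  coef :> int -> L;
  coef_bounded : exists k : int, forall i, k < i -> coef i = 0
}.

Section LaurentZmodule.
Variable L : fieldType.
Implicit Types f g h : laurent L.

Lemma laurentP f g : (forall i, f i = g i) -> f = g.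
Proof.
case: f g => [f fb] [g gb] /= /funext fg; subst g.
by congr Laurent; exact: Prop_irrelevance.
Qed.

Lemma bounded0 : exists k : int, forall i, k < i -> (0 : L) = 0.
Proof. by exists 0. Qed.

Lemma boundedN f : exists k : int, forall i, k < i -> - f i = 0.
Proof.
by have [k fk] := coef_bounded f; exists k => i /fk ->; rewrite oppr0.
Qed.

Lemma boundedD f g : exists k : int, forall i, k < i -> f i + g i = 0.
Proof.
have [k fk] := coef_bounded f; have [l gl] := coef_bounded g.
exists (Num.max k l) => i; rewrite gt_max => /andP[/fk -> /gl ->].
by rewrite addr0.
Qed.

Definition laurent_zero := Laurent bounded0.
Definition laurent_opp f := Laurent (boundedN f).
Definition laurent_add f g := Laurent (boundedD f g).

HB.instance Definition _ := gen_eqMixin (laurent L).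
HB.instance Definition _ := gen_choiceMixin (laurent L).

Fact laurent_addA : associative laurent_add.
Proof. by move=> f g h; apply: laurentP => i /=; rewrite addrA. Qed.

Fact laurent_addC : commutative laurent_add.
Proof. by move=> f g; apply: laurentP => i /=; rewrite addrC. Qed.

Fact laurent_add0 : left_id laurent_zero laurent_add.
Proof. by move=> f; apply: laurentP => i /=; rewrite add0r. Qed.

Fact laurent_addN : left_inverse laurent_zero laurent_opp laurent_add.
Proof. by move=> f; apply: laurentP => i /=; rewrite addNr. Qed.

HB.instance Definition _ := GRing.isZmodule.Build (laurent L)
  laurent_addA laurent_addC laurent_add0 laurent_addN.

HB.instance Definition _ := isPointed.Build (laurent L) 0.

Lemma coefD f g i : (f + g) i = f i + g i. Proof. by []. Qed.
Lemma coefN f i : (- f) i = - f i. Proof. by []. Qed.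
Lemma coef0 i : (0 : laurent L) i = 0. Proof. by []. Qed.

End LaurentZmodule.

Section Series.
Variable L : fieldType.

Lemma series_bounded (k : int) (c : below k -> L) :
  exists l : int, forall i, l < i -> oapp c 0 (insub i) = 0.
Proof. by exists k => i ki; rewrite insubF // leNgt ki. Qed.

(* [\sum_(i <= k) T^i c_i] *)
Definition lseries (k : int) (c : below k -> L) : laurent L :=
  Laurent (series_bounded c).

Lemma mono_bounded (k : int) (a : L) :
  exists l : int, forall i, l < i -> (if i == k then a else 0) = 0.
Proof. by exists k => i ki; rewrite gt_eqF. Qed.

(* [T^k a]; in particular [mono 0 a] is [a] seen as a Laurent series. *)
Definition mono (k : int) (a : L) : laurent L := Laurent (mono_bounded k a).

End Series.

Section Degree.
Variable L : fieldType.
Implicit Types f g h : laurent L.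

Definition is_degree f (k : int) := f k != 0 /\ forall i, k < i -> f i = 0.

(* Values in [\bar int]; [+oo] is never attained. *)
Definition deg f : \bar int :=
  if f == 0 then -oo%E else (xget 0 [set k | is_degree f k])%:E.

Lemma is_degree_uniq f k l : is_degree f k -> is_degree f l -> k = l.
Proof.
move=> [fk ltk] [fl ltl]; apply/eqP; rewrite eq_le !leNgt.
apply/andP; split; apply/negP.
  by move/ltl/eqP; apply/negP.
by move/ltk/eqP; apply/negP.
Qed.

Lemma is_degree_ex f : f != 0 -> exists k, is_degree f k.
Proof.
move=> f0; have [k fk] := coef_bounded f.
have [j fj] : exists j, f j != 0.
  apply: contrapT => nf; move/negP: f0; apply; apply/eqP/laurentP => i.
  by apply: contrapT => /eqP fi; apply: nf; exists i.
have jk : j <= k by rewrite leNgt; apply/negP => /fk /eqP; apply/negP.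
have exn : exists n : nat, f (k - n%:Z) != 0.
  by exists `|k - j|%N; rewrite gez0_abs ?subr_ge0// subKr.
exists (k - (ex_minn exn)%:Z); case: ex_minnP => n fn minn.
split=> // i lti; apply: contrapT => /eqP fi.
have ik : i <= k by rewrite leNgt; apply/negP => /fk /eqP; apply/negP.
have := minn `|k - i|%N.
rewrite gez0_abs ?subr_ge0// subKr => /(_ fi).
rewrite -lez_nat gez0_abs ?subr_ge0// lerBrDr -lerBrDl leNgt.
by rewrite lti.
Qed.

Lemma degP f k : deg f = k%:E <-> is_degree f k.
Proof.
rewrite /deg; case: eqVneq => [->|f0].
  by split=> // -[]; rewrite coef0 eqxx.
have [l fl] := is_degree_ex f0.
have -> : xget 0 [set m | is_degree f m] = l.
  by apply: xget_unique => // m fm; exact: is_degree_uniq fm fl.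
by split=> [[<-]//|/(is_degree_uniq fl) ->].
Qed.

Lemma deg_neqy f : deg f <> +oo%E.
Proof. by rewrite /deg; case: eqVneq. Qed.

Lemma deg_eqNy f : deg f = -oo%E <-> f = 0.
Proof.
by rewrite /deg; case: eqVneq => // f0; split=> // f00; rewrite f00 eqxx in f0.
Qed.

Lemma deg_ltP f (k : int) :
  (deg f < k%:E)%E <-> (forall i, k <= i -> f i = 0).
Proof.
have [->|f0] := eqVneq f 0.
  by rewrite (deg_eqNy 0).2// ltNyr; split.
have [l fl] := is_degree_ex f0; rewrite ((degP f l).2 fl) lte_fin.
have [fl0 flt] := fl.
split=> [lk i ki|fk]; first by apply: flt; exact: lt_le_trans ki.
by rewrite ltNge; apply/negP => /fk /eqP; apply/negP.
Qed.

Definition laurent_dist f g : Rdefinitions.R :=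
  if deg (f - g) is k%:E then expR k%:~R else 0.

Lemma dist_lt f g (k : int) :
  laurent_dist f g < expR k%:~R <-> (deg (f - g)%R < k%:E)%E.
Proof.
rewrite /laurent_dist; case e: (deg (f - g)) => [l||] /=.
- by rewrite ltr_expR ltr_int lte_fin.
- by have := @deg_neqy (f - g); rewrite e.
- by rewrite expR_gt0 ltNyr.
Qed.

Fact distxx f : laurent_dist f f = 0.
Proof. by rewrite /laurent_dist subrr (deg_eqNy 0).2. Qed.

Fact dist_eq0 f g : laurent_dist f g = 0 -> f = g.
Proof.
rewrite /laurent_dist; case e: (deg (f - g)) => [l||].
- by move/eqP; rewrite gt_eqF // expR_gt0.
- by have := @deg_neqy (f - g); rewrite e.
- by move/deg_eqNy: e => /subr0_eq.
Qed.

Lemma dist_ge0 f g : 0 <= laurent_dist f g.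
Proof. by rewrite /laurent_dist; case: (deg _) => // l; exact: expR_ge0. Qed.

Lemma degN f : deg (- f) = deg f.
Proof.
have [->|f0] := eqVneq f 0; first by rewrite oppr0.
have [l fl] := is_degree_ex f0; rewrite ((degP f l).2 fl); apply/degP.
by case: fl => fl fi; split=> [|i /fi e]; rewrite coefN ?oppr_eq0// e oppr0.
Qed.

Fact dist_sym f g : laurent_dist f g = laurent_dist g f.
Proof. by rewrite /laurent_dist -degN opprB. Qed.

Lemma dist_ultra g f h :
  laurent_dist f h <= Num.max (laurent_dist f g) (laurent_dist g h).
Proof.
rewrite [leLHS]/laurent_dist; case e: (deg (f - h)) => [k||]; last 2 first.
- by rewrite le_max dist_ge0.
- by rewrite le_max dist_ge0.
rewrite leNgt gt_max; apply/negP => /andP[].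
move=> /dist_lt/deg_ltP fg /dist_lt/deg_ltP gh.
have /degP[/negP + _] := e; apply; apply/eqP.
by rewrite -(subrK g f) -addrA coefD fg// gh// addr0.
Qed.

Fact dist_triangle g f h :
  laurent_dist f h <= laurent_dist f g + laurent_dist g h.
Proof.
apply: le_trans (dist_ultra g f h) _.
by rewrite ge_max lerDl lerDr !dist_ge0.
Qed.

HB.instance Definition _ := isMetric.Build Rdefinitions.R (laurent L)
  distxx dist_eq0 dist_sym dist_triangle.

End Degree.

(* The finite partial sums of the family [x], directed by inclusion of their
   index sets, converge to [s]. *)
Definition has_sum (I : choiceType) (L : fieldType) (x : I -> laurent L)
    (s : laurent L) : Prop :=
  summability.partial_sum x A @[A --> summability.totally] --> s.

Record right_deformed (L : fieldType)
    (mul : laurent L -> laurent L -> laurent L) : Prop := RightDeformed {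
  rd_mulA : associative mul;
  rd_mulDl : left_distributive mul +%R;
  rd_mulDr : right_distributive mul +%R;
  rd_continuous : continuous (fun p : laurent L * laurent L => mul p.1 p.2);
  rd_scale : forall (k : int) (a : below k -> L) (b : L),
    mul (lseries a) (mono 0 b) = lseries (fun i => a i * b);
  rd_expr : forall i j : int, mul (mono i 1) (mono j 1) = mono (i + j) 1;
  rd_deg : forall f g, deg (mul f g) = (deg f + deg g)%E
}.

Record topological_division_ring (V : PreTopologicalZmodule.type)
    (one : V) (mul : V -> V -> V) : Prop := TopologicalDivisionRing {
  tdr_mulA : associative mul;
  tdr_mul1 : right_id one mul;
  tdr_1mul : left_id one mul;
  tdr_mulDl : left_distributive mul +%R;
  tdr_mulDr : right_distributive mul +%R;
  tdr_nontrivial : one != 0;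
  tdr_add_continuous : continuous (fun p : V * V => p.1 + p.2);
  tdr_opp_continuous : continuous (fun x : V => - x);
  tdr_mul_continuous : continuous (fun p : V * V => mul p.1 p.2);
  tdr_inv : exists inv : V -> V,
    (forall x, x != 0 -> mul x (inv x) = one /\ mul (inv x) x = one) /\
    {within [set x | x != 0], continuous inv}
}.

Definition complete_space (V : puniformType) : Prop :=
  forall F : set_system V, ProperFilter F -> cauchy F -> cvg F.

Definition ring_center (V : Type) (mul : V -> V -> V) : set V :=
  [set z | forall x, mul z x = mul x z].

Section Coefficients.
Variable L : fieldType.
Variable eta : nonpos_int -> {additive L -> L}.

(* The binomial coefficient [a(a-1)...(a-k+1)/k!] of an integer [a], as an
   element of [L]; meaningful because [L] has characteristic 0. *)
Definition binz (a : int) (k : nat) : L :=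
  (\prod_(r < k) (a - r%:Z))%:~R / k`!%:R.

(* [eta_{j_1} (eta_{j_2} (... (eta_{j_k} a)))] for [s = [:: j_1; ...; j_k]] *)
Definition eta_comp (s : seq nonpos_int) (a : L) : L :=
  foldr (fun j x => eta j x) a s.

(* [j_1 + ... + j_k - k] *)
Definition weight (s : seq nonpos_int) : int :=
  \sum_(j <- s) val j - (size s)%:Z.

(* The double sum over [k > 0] and [(l, j_1, ..., j_k)] is a single sum over
   pairs [([:: j_1; ...; j_k], l)] with a nonempty first component; the index
   set is finite by [finite_leibniz_index] below. *)
Definition leibniz_index (i : int) : set (seq nonpos_int * nonpos_int) :=
  [set p | (0 < size p.1)%N /\ weight p.1 + val p.2 = i].

Definition deformed_leibniz : Prop :=
  forall (i : nonpos_int) (a b : L),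
    eta i (a * b) = a * eta i b + eta i a * b
      + \sum_(p \in leibniz_index (val i))
          binz (val p.2) (size p.1) * eta_comp p.1 a * eta p.2 b.

Definition commutation (mul : laurent L -> laurent L -> laurent L) : Prop :=
  forall a : L,
    mul (mono 0 a) (mono 1 1) =
      mono 1 a + lseries (fun i : nonpos_int => eta i a).

Definition constants : set L := [set a | forall i, eta i a = 0].

Lemma finite_nonpos_ge (N : nat) :
  finite_set [set l : nonpos_int | - N%:Z <= val l].
Proof.
have negP (n : nat) : - n%:Z <= 0 by rewrite oppr_le0.
apply: (@sub_finite_set _ _
  ((fun n : nat => exist _ (- n%:Z) (negP n) : nonpos_int) @` `I_N.+1)).
  move=> -[l l0] /= Nl; exists `|l|%N.
    by rewrite ltnS -lez_nat lez0_abs// lerNl.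
  by apply: val_inj => /=; rewrite lez0_abs// opprK.
by apply: finite_image; exact: finite_II.
Qed.

Lemma weight_cons (j : nonpos_int) s : weight (j :: s) = val j - 1 + weight s.
Proof.
by rewrite /weight big_cons /= intS opprD addrACA.
Qed.

Lemma weight_le0 s : weight s <= 0.
Proof.
elim: s => [|j s IH]; first by rewrite /weight big_nil.
by rewrite weight_cons -[leRHS](addr0 0) lerD// subr_le0 (le_trans (valP j)).
Qed.

Lemma finite_weight_ge (N : nat) : finite_set [set s | - N%:Z <= weight s].
Proof.
elim: N => [|N IH].
  apply: (@sub_finite_set _ _ [set [::]]); last exact: finite_set1.
  move=> [|j s] //=; rewrite weight_cons leNgt oppr0 => /negP[].
  rewrite -addrA -[ltRHS]addr0 ler_ltD//; first exact: (valP j).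
  by rewrite ltr_wnDr// weight_le0.
apply: (@sub_finite_set _ _ ([set [::]] `|`
  ((fun p : nonpos_int * seq nonpos_int => p.1 :: p.2) @`
    ([set l : nonpos_int | - N%:Z <= val l] `*`
     [set s | - N%:Z <= weight s])))).
  move=> [|j s] /=; first by left.
  rewrite weight_cons -addn1 PoszD opprD => h; right; exists (j, s) => //=.
  have {}h : - N%:Z <= val j + weight s by move: h; rewrite addrAC lerD2r.
  split; apply: le_trans h _.
    by rewrite gerDl weight_le0.
  by rewrite gerDr (valP j).
rewrite finite_setU; split; first exact: finite_set1.
by apply: finite_image; apply: finite_setX => //; exact: finite_nonpos_ge.
Qed.

Lemma finite_leibniz_index (i : int) : finite_set (leibniz_index i).
Proof.
apply: (@sub_finite_set _ _
  ([set s | - `|i|%N%:Z <= weight s] `*`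
   [set l : nonpos_int | - `|i|%N%:Z <= val l])).
  move=> [s l] [/= _ <-].
  have h : - `|(weight s + val l)%R|%N%:Z <= weight s + val l.
    by rewrite abszE lerNl -normrN ler_norm.
  split; apply: le_trans h _.
    by rewrite gerDl (valP l).
  by rewrite gerDr weight_le0.
by apply: finite_setX; [exact: finite_weight_ge|exact: finite_nonpos_ge].
Qed.

End Coefficients.

(* Main.v *)
Require Import Defs.
From HB Require Import structures.
From mathcomp Require Import all_boot all_order all_algebra finmap.
From mathcomp Require Import all_classical all_reals all_analysis.
From mathcomp Require Import Rstruct.
From mathcomp Require Import zify ring.

(** Every product considered is additive and shifts degrees by a bounded
    amount, and an additive map with bounded degree shift is determined by its
    values on monomials. Hence [f * g = \sum_j (f T^j) g_j], where right
    multiplication by [T^j] is forced by [a T^j = \sum_s binz j |s| T^(j +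
    weight s) eta_s(a)]: Pascal's rule says that multiplying this series by [T]
    on the right replaces [j] by [j + 1], and right multiplication by [T] is
    injective, so negative [j] are covered too. This gives uniqueness for an
    arbitrary [eta]. Associativity of the product so defined reduces, again by
    testing on monomials and by shifting the exponent of [T] by one up or down,
    to [(a b) T = a (b T)], whose coefficients are the Leibniz rule. Inverses
    are geometric series, and a series of degree [m] commuting with [L] has
    [m eta_j(a) = 0] for the top [j] with [eta_j <> 0], hence [m = 0]. *)

Import Order.TTheory GRing.Theory Num.Theory.

Set Implicit Arguments.
Unset Strict Implicit.
Unset Printing Implicit Defensive.

Local Open Scope classical_set_scope.
Local Open Scope ring_scope.

(** * Two-sided induction on the integers and finitely supported sums *)

Lemma int_bi_ind (P : int -> Prop) :
  P 0 -> (forall k, P k -> P (k + 1)) -> (forall k, P (k + 1) -> P k) ->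
  forall k, P k.
Proof.
move=> P0 up down; elim/int_ind => // n IH.
  by rewrite intS addrC; exact: up.
by apply: down; rewrite intS opprD addrAC addNr add0r.
Qed.

Section FiniteSupport.
Variables (T : choiceType) (V : zmodType).
Implicit Types (f g : T -> V) (D : set T).

Lemma fsum_supp D f :
  (forall i, ~ D i -> f i = 0) -> \sum_(i \in [set: T]) f i = \sum_(i \in D) f i.
Proof. by move=> fD; apply/esym/fsbig_widen => // i [_ /fD]. Qed.

Lemma fsumD D f g : finite_set D ->
  \sum_(i \in D) (f i + g i) = \sum_(i \in D) f i + \sum_(i \in D) g i.
Proof. by move=> fD; rewrite !fsbig_finite// big_split. Qed.

Lemma fsumB D f g : finite_set D ->
  \sum_(i \in D) (f i - g i) = \sum_(i \in D) f i - \sum_(i \in D) g i.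
Proof. by move=> fD; rewrite !fsbig_finite// sumrB. Qed.

End FiniteSupport.

Lemma finite_int_itv (l m : int) : finite_set [set i : int | l <= i <= m].
Proof.
apply: (@sub_finite_set _ _ ((fun n : nat => l + n%:Z) @` `I_`|(m - l)%R|%N.+1)).
  move=> i /= /andP[li im]; exists `|(i - l)%R|%N; lia.
by apply: finite_image; exact: finite_II.
Qed.

(** * The degree filtration and additive maps with bounded degree shift *)

Section Filtration.
Variable L : fieldType.
Implicit Types (f g h : laurent L) (A B : laurent L -> laurent L) (k d m n : int).

Definition ledeg k f := forall i, k < i -> f i = 0.

Lemma ledeg_ex f : exists k, ledeg k f.
Proof. exact: coef_bounded. Qed.

Lemma ledeg_le k m f : k <= m -> ledeg k f -> ledeg m f.
Proof. by move=> km fk i mi; apply: fk; exact: le_lt_trans mi. Qed.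

Lemma ledegD k f g : ledeg k f -> ledeg k g -> ledeg k (f + g).
Proof. by move=> fk gk i ki; rewrite Defs.coefD fk// gk// addr0. Qed.

Lemma ledegN k f : ledeg k f -> ledeg k (- f).
Proof. by move=> fk i ki; rewrite Defs.coefN fk// oppr0. Qed.

Lemma ledegB k f g : ledeg k f -> ledeg k g -> ledeg k (f - g).
Proof. by move=> fk gk; apply: ledegD => //; exact: ledegN. Qed.

Lemma ledeg_all f : (forall k, ledeg k f) -> f = 0.
Proof. by move=> fk; apply: laurentP => i; apply: (fk (i - 1)); lia. Qed.

Lemma coef_mono k (a : L) i : mono k a i = if i == k then a else 0.
Proof. by []. Qed.

Lemma laurent_coefB f g i : (f - g) i = f i - g i. Proof. by []. Qed.

Lemma laurent_coef_sum (I : Type) (r : seq I) (P : pred I) (x : I -> laurent L) n :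
  (\sum_(i <- r | P i) x i) n = \sum_(i <- r | P i) x i n.
Proof. by elim/big_rec2: _ => // i y z _ <-; rewrite Defs.coefD. Qed.

Lemma ledeg_mono k (a : L) : ledeg k (mono k a).
Proof. by move=> i ki; rewrite coef_mono gt_eqF. Qed.

Lemma mono_neq0 k (a : L) : a != 0 -> mono k a != 0.
Proof.
apply: contraNneq => /(congr1 (fun f : laurent L => f k))/eqP.
by rewrite coef_mono eqxx.
Qed.

Lemma ledeg_tail k f : ledeg k f -> ledeg (k - 1) (f - mono k (f k)).
Proof.
move=> fk i ki; rewrite laurent_coefB coef_mono.
by have [->|ik] := eqVneq i k; rewrite ?subrr// fk ?subr0//; lia.
Qed.

Definition filtered d A :=
  zmod_morphism A /\ forall k f, ledeg k f -> ledeg (k + d) (A f).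

Lemma filtered0 d A : filtered d A -> A 0 = 0.
Proof. by move=> [AB _]; rewrite -[X in A X](subrr 0) AB subrr. Qed.

Lemma filteredB d A f g : filtered d A -> A (f - g) = A f - A g.
Proof. by move=> [AB _]. Qed.

Lemma filteredN d A f : filtered d A -> A (- f) = - A f.
Proof. by move=> fA; rewrite -sub0r (filteredB _ _ fA) (filtered0 fA) sub0r. Qed.

Lemma filteredD d A f g : filtered d A -> A (f + g) = A f + A g.
Proof.
by move=> fA; rewrite -[g]opprK (filteredB _ _ fA) (filteredN _ fA) !opprK.
Qed.

Lemma filtered_sum d A (I : Type) (r : seq I) (x : I -> laurent L) :
  filtered d A -> A (\sum_(i <- r) x i) = \sum_(i <- r) A (x i).
Proof.
by move=> fA; exact: (big_morph A (fun f g => filteredD f g fA) (filtered0 fA)).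
Qed.

Lemma filtered_id : filtered 0 id.
Proof. by split=> // k f; rewrite addr0. Qed.

Lemma filtered_comp d e A B :
  filtered d A -> filtered e B -> filtered (d + e) (fun f => A (B f)).
Proof.
move=> fA fB; split=> [f g|k f /fB.2 /fA.2]; first by rewrite fB.1 fA.1.
by apply: ledeg_le; lia.
Qed.

Lemma filtered_sub d A B :
  filtered d A -> filtered d B -> filtered d (fun f => A f - B f).
Proof.
move=> [AB Ad] [BB Bd]; split=> [f g|k f fk]; last exact: ledegB (Ad _ _ fk) (Bd _ _ fk).
by rewrite AB BB opprD addrACA -opprD.
Qed.

Lemma filtered_le d e A : d <= e -> filtered d A -> filtered e A.
Proof. by move=> de [AB Ad]; split=> // k f /Ad; apply: ledeg_le; lia. Qed.

(** Subtracting leading monomials one by one does not change the image, so [A f = A g] with [g] of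
    arbitrarily low degree, and [A f] lies in every step of the filtration. *)
Lemma filtered_eq0 d A :
  filtered d A -> (forall k a, A (mono k a) = 0) -> forall f, A f = 0.
Proof.
move=> fA A0 f; have [m fm] := ledeg_ex f.
have trunc (N : nat) : exists2 g, ledeg (m - N%:Z) g & A f = A g.
  elim: N => [|N [g gm Afg]]; first by exists f => //; rewrite subr0.
  exists (g - mono (m - N%:Z) (g (m - N%:Z))).
    by apply: ledeg_le (ledeg_tail gm); lia.
  by rewrite (filteredB _ _ fA) A0 subr0.
(* This [N] gives [m - N + d <= k]. *)
apply: ledeg_all => k; have [g gm ->] := trunc `|(m - k + d)%R|%N.
by apply: ledeg_le (fA.2 _ _ gm); lia.
Qed.

Lemma filtered_ext d e A B : filtered d A -> filtered e B ->
  (forall k a, A (mono k a) = B (mono k a)) -> forall f, A f = B f.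
Proof.
move=> fA fB AB f; apply/eqP; rewrite -subr_eq0; apply/eqP.
have fAB : filtered (Num.max d e) (fun f => A f - B f).
  apply: filtered_sub.
    by apply: filtered_le fA; rewrite le_max lexx.
  by apply: filtered_le fB; rewrite le_max lexx orbT.
by apply: (filtered_eq0 fAB) => k a; rewrite AB subrr.
Qed.

(* The geometric series [\sum_r A^r g]. *)
Lemma filtered_fixpoint A g : filtered (-1) A -> exists f, f - A f = g.
Proof.
move=> fA; have [m gm] := ledeg_ex g.
pose p r := iter r A g; pose S N : laurent L := \sum_(0 <= r < N) p r.
have pm r : ledeg (m - r%:Z) (p r).
  elim: r => [|r IH]; first by rewrite subr0.
  by apply: ledeg_le (fA.2 _ _ IH); lia.
have Sm N i : m - N%:Z < i -> forall N', (N <= N')%N -> S N' i = S N i.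
  move=> Ni N' NN'; rewrite /S !laurent_coef_sum (big_cat_nat (n := N))//=.
  rewrite [X in _ + X]big_nat_cond [X in _ + X]big1 ?addr0// => r; rewrite andbT => /andP[Nr _].
  by apply: (pm r); lia.
(* The coefficient in degree [i] no longer changes once [m - N < i], so the limit reads it off at
   [N = |m - i| + 1]. *)
have fb : exists k, forall i, k < i -> S `|(m - i)%R|%N.+1 i = 0.
  exists m => i mi; rewrite /S laurent_coef_sum big1// => r _.
  by apply: (pm r); lia.
pose f := Laurent fb; exists f.
have fS N : ledeg (m - N%:Z) (f - S N).
  move=> i Ni; rewrite laurent_coefB /f /=; apply/eqP; rewrite subr_eq0; apply/eqP.
  have [l|l] := leqP N `|(m - i)%R|%N.+1; first exact: Sm.
  by apply/esym; apply: Sm => //; [lia|exact: ltnW].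
have SA N : S N - A (S N) = g - p N.
  elim: N => [|N IH].
    by rewrite /S big_nil (filtered0 fA) subr0 subrr.
  rewrite /S big_nat_recr//= -/(S N) (filteredD _ _ fA) opprD addrACA IH.
  by rewrite addrA subrK.
apply/eqP; rewrite -subr_eq0; apply/eqP/ledeg_all => k.
(* The defect is [1 - A] applied to the remainder [f - S N], minus the last power [A^N g]; this [N]
   brings both down to degree [k]. *)
pose N := `|(m - k)%R|%N.
have -> : f - A f - g = (f - S N) - A (f - S N) - p N.
  have -> : g = S N - A (S N) + p N by rewrite SA subrK.
  rewrite (filteredB _ _ fA); apply: laurentP => i.
  by rewrite !(laurent_coefB, Defs.coefD) /=; ring.
apply: ledegB; last by apply: ledeg_le (pm N); lia.
apply: ledegB; first by apply: ledeg_le (fS N); lia.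
by apply: ledeg_le (fA.2 _ _ (fS N)); lia.
Qed.

Fact shiftT_bounded k f : exists m, forall i, m < i -> f (i - k) = 0.
Proof. by have [m fm] := ledeg_ex f; exists (m + k) => i mi; apply: fm; lia. Qed.

(** Left multiplication by [T^k]: coefficients stand to the right of the powers of [T], so exponents
    are merely translated. *)
Definition shiftT k f : laurent L := Laurent (shiftT_bounded k f).

Fact scale_bounded (b : L) f : exists m, forall i, m < i -> f i * b = 0.
Proof. by have [m fm] := ledeg_ex f; exists m => i /fm ->; rewrite mul0r. Qed.

Definition scale (b : L) f : laurent L := Laurent (scale_bounded b f).

Lemma filtered_shift k : filtered k (shiftT k).
Proof.
split=> [f g|m f fm i mi /=]; first by apply: laurentP.
by apply: fm; lia.
Qed.

Lemma filtered_scale b : filtered 0 (scale b).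
Proof.
split=> [f g|m f fm i mi /=]; last by rewrite fm ?mul0r//; lia.
by apply: laurentP => i /=; rewrite mulrBl.
Qed.

Lemma scaleBl a b f : scale (a - b) f = scale a f - scale b f.
Proof. by apply: laurentP => i /=; rewrite mulrBr. Qed.

Lemma scale1 f : scale 1 f = f.
Proof. by apply: laurentP => i /=; rewrite mulr1. Qed.

Lemma scale_scale a b f : scale a (scale b f) = scale (b * a) f.
Proof. by apply: laurentP => i /=; rewrite mulrA. Qed.

Lemma scale_mono k a b : scale b (mono k a) = mono k (a * b).
Proof. by apply: laurentP => i /=; case: eqP; rewrite ?mul0r. Qed.

Lemma shiftT_mono k m a : shiftT k (mono m a) = mono (k + m) a.
Proof. by apply: laurentP => i /=; rewrite subr_eq [m + k]addrC. Qed.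

Lemma shiftT_shift k m f : shiftT k (shiftT m f) = shiftT (k + m) f.
Proof. by apply: laurentP => i /=; congr (f _); lia. Qed.

Lemma shiftT0 f : shiftT 0 f = f.
Proof. by apply: laurentP => i /=; rewrite subr0. Qed.

Lemma shiftT_scale k b f : shiftT k (scale b f) = scale b (shiftT k f).
Proof. by apply: laurentP. Qed.

Lemma coef_lseries k (c : below k -> L) i (ik : i <= k) :
  lseries c i = c (exist _ i ik).
Proof. by rewrite /= insubT. Qed.

Lemma ledeg_lseries k (c : below k -> L) : ledeg k (lseries c).
Proof. by move=> i ki /=; rewrite insubF// leNgt ki. Qed.

Lemma lseries_coef k f : ledeg k f -> f = lseries (fun i : below k => f (val i)).
Proof.
move=> fk; apply: laurentP => i.
have [ik|ki] := leP i k; first by rewrite coef_lseries.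
by rewrite fk// ledeg_lseries.
Qed.

End Filtration.

Arguments ledeg_mono {L} k a.

(** * Extension of maps from monomials to all Laurent series *)

Section Extension.
Variable L : fieldType.
Implicit Types (phi : int -> L -> laurent L) (f : laurent L).

Definition mono_filtered d phi := (forall i, zmod_morphism (phi i)) /\
  forall i a, ledeg (i + d) (phi i a).

(* [\sum_i phi i (f i)], the filtered extension of [mono i a |-> phi i a];
   [0] by convention when the sum is not a Laurent series. *)
Definition ext phi f : laurent L :=
  xget 0 [set g : laurent L | forall n, g n = \sum_(i \in [set: int]) phi i (f i) n].

Lemma mono_filtered0 d phi i : mono_filtered d phi -> phi i 0 = 0.
Proof. by move=> [phiB _]; rewrite -[X in phi i X](subrr 0) phiB subrr. Qed.

(** Above [m] the coefficient [f i] vanishes, and below [n - d] the series [phi i (f i)] cannot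
    reach degree [n]. Hence every coefficient of the extension is a finite sum. *)
Lemma mono_filtered_supp d phi m f n i : mono_filtered d phi -> ledeg m f ->
  ~ (n - d <= i <= m) -> phi i (f i) n = 0.
Proof.
move=> fphi fm /negP; rewrite negb_and -!ltNge => /orP[ni|mi].
  by apply: fphi.2; lia.
by rewrite fm// (mono_filtered0 _ fphi).
Qed.

Lemma coef_ext_itv d phi m f n : mono_filtered d phi -> ledeg m f ->
  ext phi f n = \sum_(i \in [set i | n - d <= i <= m]) phi i (f i) n.
Proof.
move=> fphi fm; rewrite -(fsum_supp (f := fun i => phi i (f i) n)); last first.
  by move=> i; exact: mono_filtered_supp fphi fm.
(* The sums vanish beyond degree [m + d], so they form a Laurent series and [xget] does not return
   its default. *)
have bnd : exists k, forall n, k < n ->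
    \sum_(i \in [set: int]) phi i (f i) n = 0.
  exists (m + d) => {}n mn; apply: fsbig1 => i _.
  by apply: (mono_filtered_supp fphi fm); lia.
have extP : [set g : laurent L |
    forall n, g n = \sum_(i \in [set: int]) phi i (f i) n] (Laurent bnd) by [].
exact: (xgetI 0 extP n).
Qed.

Lemma coef_ext d phi f n : mono_filtered d phi ->
  ext phi f n = \sum_(i \in [set: int]) phi i (f i) n.
Proof.
move=> fphi; have [m fm] := ledeg_ex f; rewrite (coef_ext_itv _ fphi fm).
by rewrite -fsum_supp// => i; exact: mono_filtered_supp fphi fm.
Qed.

Lemma filtered_ext_phi d phi : mono_filtered d phi -> filtered d (ext phi).
Proof.
move=> fphi; split=> [f g|k f fk].
  apply: laurentP => n; have [m fm] := ledeg_ex f; have [l gl] := ledeg_ex g.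
  have fm' : ledeg (Num.max m l) f by apply: ledeg_le fm; rewrite le_max lexx.
  have gl' : ledeg (Num.max m l) g.
    by apply: ledeg_le gl; rewrite le_max lexx orbT.
  rewrite laurent_coefB (coef_ext_itv _ fphi fm') (coef_ext_itv _ fphi gl').
  rewrite (coef_ext_itv _ fphi (ledegB fm' gl')) -fsumB; last exact: finite_int_itv.
  by apply: eq_fsbigr => i _; rewrite laurent_coefB fphi.1.
move=> n kn; rewrite (coef_ext_itv _ fphi fk) fsbig1// => i /= /andP[]; lia.
Qed.

Lemma ext_mono d phi k a : mono_filtered d phi -> ext phi (mono k a) = phi k a.
Proof.
move=> fphi; apply: laurentP => n; rewrite (coef_ext _ _ fphi).
rewrite (fsum_supp (D := [set k])) ?fsbig_set1 ?coef_mono ?eqxx// => i /= /eqP ik.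
by rewrite (negPf ik) (mono_filtered0 _ fphi).
Qed.

End Extension.

(** Extending the inner sums by zero to the finite union [S] of the sets [W i] reduces a dependent
    double sum to a sum over a product. *)
Lemma fsum_sigma (I J : choiceType) (V : zmodType) (D : set I) (W : I -> set J)
    (F : I -> J -> V) : finite_set D -> (forall i, D i -> finite_set (W i)) ->
  \sum_(i \in D) \sum_(j \in W i) F i j =
  \sum_(p \in [set p | D p.1 /\ W p.1 p.2]) F p.1 p.2.
Proof.
move=> Dfin Wfin; pose S := \bigcup_(i in D) W i.
have Sfin : finite_set S by exact: bigcup_finite.
pose G i j := if j \in W i then F i j else 0.
transitivity (\sum_(i \in D) \sum_(j \in S) G i j).
  apply: eq_fsbigr => i /set_mem Di.
  transitivity (\sum_(j \in W i) G i j).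
    by apply: eq_fsbigr => j jW; rewrite /G jW.
  apply: fsbig_widen => [j Wj|j [_ Wj]]; first by exists i.
  by rewrite /G /= memNset.
rewrite pair_fsbig//.
transitivity (\sum_(p \in [set p | D p.1 /\ W p.1 p.2]) G p.1 p.2).
  apply/esym/fsbig_widen => [[i j] [/= Di Wij]|[i j] [[/= Di _] nW]].
    by split=> //; exists i.
  by rewrite /= /G memNset// => Wij; apply: nW.
by apply: eq_fsbigr => -[i j] /set_mem [/= _ Wij]; rewrite /G mem_set.
Qed.

(** * Integer binomial coefficients in characteristic 0 *)

Section Binomial.
Variable L : fieldType.
Hypothesis charL : [pchar L] =i pred0.

Lemma binz0 a : binz L a 0 = 1.
Proof. by rewrite /binz big_ord0 divr1. Qed.

Lemma binz0S k : binz L 0 k.+1 = 0.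
Proof. by rewrite /binz big_ord_recl /= subrr mul0r mul0r. Qed.

Lemma binz1 a : binz L a 1 = a%:~R.
Proof. by rewrite /binz big_ord_recl big_ord0 /= subr0 mulr1 divr1. Qed.

Lemma natr_neq0 n : n.+1%:R != 0 :> L.
Proof. by have /pcharf0P -> := charL. Qed.

Lemma intr_eq0_char0 (n : int) : (n%:~R == 0 :> L) = (n == 0).
Proof.
by case: n => n; rewrite ?NegzE ?mulrNz ?oppr_eq0 -?pmulrn; have /pcharf0P -> := charL.
Qed.

(** Pascal's rule: with [P = a (a - 1) ... (a - k + 1)], both sides equal [(a + 1) P / (k + 1)!].
    Characteristic 0 makes the factorials invertible. *)
Lemma binzS a k : binz L (a + 1) k.+1 = binz L a k.+1 + binz L a k.
Proof.
rewrite /binz [in LHS]big_ord_recl [in X in _ = X + _]big_ord_recr /=.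
have bumpE (i : nat) : a + 1 - (bump 0 i)%:Z = a - i%:Z by rewrite /bump; lia.
under eq_bigr do rewrite bumpE.
set P := \prod_(_ < k) _; rewrite subr0 factS !natrM.
have k0 : (k`!)%:R != 0 :> L by rewrite -(prednK (fact_gt0 k)) natr_neq0.
rewrite !rmorphM /= !(rmorphD, rmorphN, rmorph1) /= -pmulrn.
have := natr_neq0 k; rewrite -natr1 => k1.
by field; rewrite k0 k1.
Qed.

(** Integrality lets the additive maps [eta j] pass through binomial coefficients. Pascal's rule
    propagates it in [a] in both directions. *)
Lemma binz_int a k : exists m : int, binz L a k = m%:~R.
Proof.
elim: k a => [|k IH] a; first by exists 1; rewrite binz0.
elim/int_bi_ind: a => [|a [m am]|a [m am]]; first by exists 0; rewrite binz0S.
  by have [l al] := IH a; exists (m + l); rewrite binzS am al rmorphD.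
have [l al] := IH a; exists (m - l).
by rewrite rmorphB /= -am -al binzS addrK.
Qed.

End Binomial.

(** * The coefficients of [a T^j] *)

Section CommutationSeries.
Variable L : fieldType.
Hypothesis charL : [pchar L] =i pred0.
Variable eta : nonpos_int -> {additive L -> L}.
Implicit Types (a b c : L) (f g h : laurent L) (s : seq nonpos_int).

Lemma eta_comp_cons j s a : eta_comp eta (j :: s) a = eta j (eta_comp eta s a).
Proof. by []. Qed.

Lemma eta_compB s : zmod_morphism (eta_comp eta s).
Proof.
by elim: s => [//|j s IH] a b; rewrite !eta_comp_cons IH raddfB.
Qed.

Lemma finite_weight_eq (d : int) : finite_set [set s | weight s = d].
Proof.
apply: sub_finite_set (finite_weight_ge `|d|%N) => s /= ->; lia.
Qed.

(* The coefficient of [T^(j + d)] in [a T^j]. *)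
Definition swap_coef (j d : int) a : L :=
  \sum_(s \in [set s | weight s = d]) binz L j (size s) * eta_comp eta s a.

Lemma swap_coefB j d : zmod_morphism (swap_coef j d).
Proof.
move=> a b; rewrite /swap_coef -fsumB; last exact: finite_weight_eq.
by apply: eq_fsbigr => s _; rewrite eta_compB mulrBr.
Qed.

Lemma swap_coef_gt0 j d a : 0 < d -> swap_coef j d a = 0.
Proof.
by move=> d0; apply: fsbig1 => s /= sd; have := weight_le0 s; rewrite sd leNgt d0.
Qed.

Lemma weight_nil : weight [::] = 0.
Proof. by rewrite /weight big_nil. Qed.

Lemma weight_lt0 s : (0 < size s)%N -> weight s < 0.
Proof.
by case: s => // j s _; rewrite weight_cons; have := valP j; have := weight_le0 s; lia.
Qed.

Lemma weight_eq0 : [set s | weight s = 0] = [set [::]].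
Proof.
apply/seteqP; split=> [[|j s]|s] //= => [|->]; last exact: weight_nil.
by have := @weight_lt0 (j :: s) isT; lia.
Qed.

Lemma swap_coef0 j a : swap_coef j 0 a = a.
Proof. by rewrite /swap_coef weight_eq0 fsbig_set1 binz0 mul1r. Qed.

Lemma swap_coef0l d a : swap_coef 0 d a = if d == 0 then a else 0.
Proof.
have [->|d0] := eqVneq d 0; first exact: swap_coef0.
apply: fsbig1 => -[|j s] /= sd; last by rewrite binz0S mul0r.
by rewrite -sd weight_nil eqxx in d0.
Qed.

Lemma binz1SS k : binz L 1 k.+2 = 0.
Proof. by rewrite -[1]add0r binzS// !binz0S addr0. Qed.

(** The binomial coefficient of 1 over [k] vanishes for [k >= 2] and the empty word has weight 0, so
    only the word [[:: j]], of weight [j - 1], contributes. *)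
Lemma swap_coef1 (j : nonpos_int) a : swap_coef 1 (val j - 1) a = eta j a.
Proof.
rewrite /swap_coef -(fsbig_widen [set [:: j]]) ?fsbig_set1.
- by rewrite binz1 mul1r.
- by move=> s -> /=; rewrite weight_cons weight_nil addr0.
move=> [|l [|l' s]] [/= sj sNj].
- by have /= := valP j; rewrite weight_nil in sj; lia.
- case: sNj; congr [:: _]; apply: val_inj.
  by move: sj; rewrite weight_cons weight_nil /=; lia.
- by rewrite binz1SS mul0r.
Qed.

Lemma eta_binz j l k a : eta j (binz L l k * a) = binz L l k * eta j a.
Proof. by have [m ->] := binz_int charL l k; rewrite !mulrzl raddfMz. Qed.

Lemma finite_nonpos_gt (d : int) : finite_set [set j : nonpos_int | d < val j].
Proof.
apply: sub_finite_set (finite_nonpos_ge `|d|%N) => j /=; lia.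
Qed.

(** The identity [a T^(l + 1) = (a T^l) T] in coefficients. Pascal's rule splits the weight-[d] sum;
    in its second part the word [j :: t] carries the coefficient of [t], with [eta j] applied
    last. *)
Lemma swap_coefS l d a : swap_coef (l + 1) d a = swap_coef l d a +
  \sum_(j \in [set j : nonpos_int | d < val j])
    eta j (swap_coef l (d - val j + 1) a).
Proof.
(* For the empty word Pascal's rule has no second term, hence the value 0. *)
pose G (s : seq nonpos_int) : L :=
  if s is j :: t then binz L l (size t) * eta_comp eta s a else 0.
have -> : swap_coef (l + 1) d a =
    swap_coef l d a + \sum_(s \in [set s | weight s = d]) G s.
  rewrite /swap_coef -fsumD; last exact: finite_weight_eq.
  apply: eq_fsbigr => -[|j s] _; first by rewrite !binz0 [G _]/= addr0.
  by rewrite binzS// mulrDl.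
congr (_ + _).
under [RHS]eq_fsbigr => j _.
  rewrite /swap_coef fsbig_finite; last exact: finite_weight_eq.
  rewrite raddf_sum /=; under eq_bigr do rewrite eta_binz -eta_comp_cons.
  rewrite -fsbig_finite; last exact: finite_weight_eq.
  over.
rewrite fsum_sigma; [|exact: finite_nonpos_gt|by move=> j _; exact: finite_weight_eq].
set Q := (X in _ = \sum_(p \in X) _).
(* Splitting off the first letter identifies nonempty words of weight [d] with [Q]; the bound
   [d < val j] is automatic because [weight t <= 0]. *)
transitivity (\sum_(s \in (fun p : nonpos_int * seq nonpos_int => p.1 :: p.2) @` Q) G s).
  apply/esym/fsbig_widen.
    by move=> s [[j t] [/= dj jt] <-]; rewrite /= weight_cons /=; lia.
  move=> [//|j t] [/= jt nQ]; case: nQ; exists (j, t) => //.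
  by move: jt (weight_le0 t); rewrite weight_cons /Q /= => jt t0; split; lia.
by rewrite fsbig_image// => -[j s] [k t] _ _ /= [-> ->].
Qed.

End CommutationSeries.

(** * The product determined by the commutation rule *)

Section DeformedMultiplication.
Variable L : fieldType.
Hypothesis charL : [pchar L] =i pred0.
Variable eta : nonpos_int -> {additive L -> L}.
Implicit Types (a b c : L) (f g h : laurent L) (i j k l m n : int).

Fact swap_series_bounded j a :
  exists k, forall n, k < n -> swap_coef eta j (n - j) a = 0.
Proof. by exists j => n jn; apply: swap_coef_gt0; rewrite subr_gt0. Qed.

(* [a T^j] *)
Definition swap_series j a : laurent L := Laurent (swap_series_bounded j a).

Lemma ledeg_swap_series j a : ledeg j (swap_series j a).
Proof. by move=> n jn /=; apply: swap_coef_gt0; rewrite subr_gt0. Qed.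

Lemma swap_seriesB j : zmod_morphism (swap_series j).
Proof. by move=> a b; apply: laurentP => n; rewrite laurent_coefB /= swap_coefB. Qed.

Lemma swap_series0 a : swap_series 0 a = mono 0 a.
Proof. by apply: laurentP => n; rewrite /= subr0 swap_coef0l. Qed.

Lemma swap_series1 a :
  swap_series 1 a = mono 1 a + lseries (fun i : nonpos_int => eta i a).
Proof.
apply: laurentP => n; rewrite Defs.coefD coef_mono [LHS]/=.
have [->|n1] := eqVneq n 1.
  by rewrite subrr swap_coef0 ledeg_lseries ?addr0.
have [n0|n0] := leP n 0; last first.
  by rewrite ledeg_lseries// swap_coef_gt0 ?addr0//; lia.
by rewrite coef_lseries add0r -swap_coef1.
Qed.

(* [f T^j] *)
Definition rmulT j f := ext (fun i a => shiftT i (swap_series j a)) f.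

Lemma mono_filtered_rmulT j :
  mono_filtered j (fun i a => shiftT i (swap_series j a)).
Proof.
split=> [i a b|i a]; first by rewrite swap_seriesB (filteredB _ _ (filtered_shift _ _)).
by rewrite addrC; apply: (filtered_shift L i).2; exact: ledeg_swap_series.
Qed.

Lemma filtered_rmulT j : filtered j (rmulT j).
Proof. exact: filtered_ext_phi (mono_filtered_rmulT j). Qed.

Lemma rmulT_mono j i a : rmulT j (mono i a) = shiftT i (swap_series j a).
Proof. exact: ext_mono (mono_filtered_rmulT j). Qed.

Lemma rmulT0 f : rmulT 0 f = f.
Proof.
apply: (filtered_ext (filtered_rmulT 0) (filtered_id L)) => k a.
by rewrite rmulT_mono swap_series0 shiftT_mono addr0.
Qed.

Lemma rmulT_shift j k f : rmulT j (shiftT k f) = shiftT k (rmulT j f).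
Proof.
apply: (filtered_ext (filtered_comp (filtered_rmulT j) (filtered_shift L k))
  (filtered_comp (filtered_shift L k) (filtered_rmulT j))) => m a.
by rewrite shiftT_mono !rmulT_mono shiftT_shift.
Qed.

(** In [T^i c T = T^(i + 1) c + \sum_j T^(i + j) eta_j(c)], degree [n] is reached from [i = n - 1]
    and from [i = n - j]; these are the two parts of [swap_coefS]. *)
Lemma rmulT1_swap_series l a : rmulT 1 (swap_series l a) = swap_series (l + 1) a.
Proof.
apply: laurentP => n; rewrite /rmulT (coef_ext _ _ (mono_filtered_rmulT 1)).
pose D := [set j : nonpos_int | n - (l + 1) < val j].
have Dfin : finite_set D by exact: finite_nonpos_gt.
pose h (j : nonpos_int) := n - val j.
(* The condition defining [D] says [n - j <= l]; beyond it the coefficients of [a T^l] vanish. *)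
rewrite (fsum_supp (D := [set n - 1] `|` h @` D)); last first.
  move=> i /not_orP[/= in1 iD].
  have [ni|ni] := ltP i n; first by rewrite swap_coef_gt0//; lia.
  have i0 : n - i <= 0 by lia.
  rewrite (swap_coef_gt0 eta l); last first.
    rewrite ltNge; apply/negP => il; apply: iD; exists (exist _ (n - i) i0 : nonpos_int).
      by rewrite /D /=; lia.
    by rewrite /h /=; lia.
  by rewrite -[X in swap_coef _ _ _ X](subrr 0) swap_coefB subrr.
rewrite fsbigU0 ?fsbig_set1; [|exact: finite_set1|exact: finite_image|]; last first.
  by move=> i [/= -> [j _]]; rewrite /h; have := valP j => /=; lia.
rewrite [swap_series (l + 1) a n]/= swap_coefS//; congr (_ + _).
  by rewrite /= (_ : _ - 1 = 0) ?swap_coef0; [congr swap_coef|]; lia.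
rewrite fsbig_image; last first.
  by move=> i j _ _; rewrite /h => /addrI/oppr_inj/val_inj.
apply: eq_fsbigr => j _; rewrite /h /= -(swap_coef1 charL eta).
by congr (swap_coef _ _ _ (swap_coef _ _ _ _)) => /=; lia.
Qed.

Lemma rmulT1_rmulT l f : rmulT 1 (rmulT l f) = rmulT (l + 1) f.
Proof.
apply: (filtered_ext (filtered_comp (filtered_rmulT 1) (filtered_rmulT l))
  (filtered_rmulT (l + 1))) => i a.
by rewrite !rmulT_mono rmulT_shift rmulT1_swap_series.
Qed.

Definition dmul f g := ext (fun j b => scale b (rmulT j f)) g.

Lemma mono_filtered_dmul m f : ledeg m f ->
  mono_filtered m (fun j b => scale b (rmulT j f)).
Proof.
move=> fm; split=> [j a b|j b]; first by rewrite scaleBl.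
apply: ledeg_le ((filtered_scale b).2 _ _ ((filtered_rmulT j).2 _ _ fm)); lia.
Qed.

Lemma filtered_dmulr m f : ledeg m f -> filtered m (dmul f).
Proof. by move=> fm; apply: filtered_ext_phi (mono_filtered_dmul fm). Qed.

Lemma dmul_mono f j b : dmul f (mono j b) = scale b (rmulT j f).
Proof. by have [m fm] := ledeg_ex f; apply: ext_mono (mono_filtered_dmul fm). Qed.

Lemma dmulBl f g h : dmul (f - g) h = dmul f h - dmul g h.
Proof.
have [m fm] := ledeg_ex f; have [n gn] := ledeg_ex g.
have [p fgp] := ledeg_ex (f - g).
have fgmax := filtered_sub
  (filtered_le (d := m) (e := Num.max m n) _ (filtered_dmulr fm))
  (filtered_le (d := n) (e := Num.max m n) _ (filtered_dmulr gn)).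
apply: (filtered_ext (filtered_dmulr fgp) (fgmax _ _)).
- by rewrite le_max lexx.
- by rewrite le_max lexx orbT.
move=> j b; rewrite !dmul_mono (filteredB _ _ (filtered_rmulT j)).
exact: filteredB (filtered_scale b).
Qed.

Lemma filtered_dmull m g : ledeg m g -> filtered m (dmul^~ g).
Proof.
move=> gm; split=> [f h|k f fk]; first exact: dmulBl.
by rewrite addrC; exact: (filtered_dmulr fk).2.
Qed.

Lemma ledeg_dmul m n f g : ledeg m f -> ledeg n g -> ledeg (m + n) (dmul f g).
Proof. by move=> fm gn; exact: (filtered_dmull gn).2. Qed.

Lemma dmulBr f g h : dmul f (g - h) = dmul f g - dmul f h.
Proof. by have [m fm] := ledeg_ex f; apply: filteredB (filtered_dmulr fm). Qed.

Lemma dmulDr f g h : dmul f (g + h) = dmul f g + dmul f h.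
Proof. by have [m fm] := ledeg_ex f; apply: filteredD (filtered_dmulr fm). Qed.

Lemma dmulDl f g h : dmul (f + g) h = dmul f h + dmul g h.
Proof. by have [m hm] := ledeg_ex h; apply: filteredD (filtered_dmull hm). Qed.

Lemma dmul0r f : dmul f 0 = 0.
Proof. by have [m fm] := ledeg_ex f; apply: filtered0 (filtered_dmulr fm). Qed.

Lemma dmul0l f : dmul 0 f = 0.
Proof. by have [m fm] := ledeg_ex f; apply: filtered0 (filtered_dmull fm). Qed.

Lemma rmulTE j f : rmulT j f = dmul f (mono j 1).
Proof. by rewrite dmul_mono scale1. Qed.

Lemma dmul_scalar f b : dmul f (mono 0 b) = scale b f.
Proof. by rewrite dmul_mono rmulT0. Qed.

Lemma dmul1 f : dmul f (mono 0 1) = f.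
Proof. by rewrite dmul_scalar scale1. Qed.

Lemma scale_dmul b f g : scale b (dmul f g) = dmul f (scale b g).
Proof.
have [m fm] := ledeg_ex f.
apply: (filtered_ext (filtered_comp (filtered_scale b) (filtered_dmulr fm))
  (filtered_comp (filtered_dmulr fm) (filtered_scale b))) => j c.
by rewrite scale_mono !dmul_mono scale_scale.
Qed.

Lemma shiftT_dmul k f g : shiftT k (dmul f g) = dmul (shiftT k f) g.
Proof.
have [m fm] := ledeg_ex f.
apply: (filtered_ext (filtered_comp (filtered_shift L k) (filtered_dmulr fm))
  (filtered_dmulr ((filtered_shift L k).2 _ _ fm))) => j c.
by rewrite !dmul_mono rmulT_shift shiftT_scale.
Qed.

Lemma mono_shift k a : mono k a = shiftT k (mono 0 a).
Proof. by rewrite shiftT_mono addr0. Qed.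

(** After splitting off the monomials of degrees [m] and [n], the products involving a tail stay
    below degree [m + n], and [a T^n] has leading coefficient [a]. *)
Lemma dmul_lead m n f g : ledeg m f -> ledeg n g ->
  dmul f g (m + n) = f m * g n.
Proof.
move=> fm gn.
have <- : dmul (mono m (f m)) (mono n (g n)) (m + n) = f m * g n.
  rewrite dmul_mono rmulT_mono /= (_ : m + n - m - n = 0) ?swap_coef0//; lia.
have low k l f' g' : ledeg k f' -> ledeg l g' -> k + l < m + n ->
    dmul f' g' (m + n) = 0 by move=> fk gl; exact: ledeg_dmul fk gl (m + n).
rewrite -[f in LHS](subrK (mono m (f m))) dmulDl Defs.coefD.
rewrite (low (m - 1) n) ?add0r//; [|exact: ledeg_tail|lia].
rewrite -[g in LHS](subrK (mono n (g n))) dmulDr Defs.coefD.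
by rewrite (low m (n - 1)) ?add0r//; [exact: ledeg_mono|exact: ledeg_tail|lia].
Qed.

End DeformedMultiplication.
Arguments ledeg_swap_series {L} eta j a.
Arguments ledeg_dmul {L} eta {m n f g}.

(** * The Leibniz rule and associativity *)

Section Associativity.
Variable L : fieldType.
Hypothesis charL : [pchar L] =i pred0.
Variable eta : nonpos_int -> {additive L -> L}.
Implicit Types (a b c : L) (f g h : laurent L) (i j k l m n : int).

Local Notation swap_series := (swap_series eta).
Local Notation rmulT := (rmulT eta).
Local Notation dmul := (dmul eta).

Lemma dmul_neq0 f g : f != 0 -> g != 0 -> dmul f g != 0.
Proof.
move=> /is_degree_ex[m [fm0 fm]] /is_degree_ex[n [gn0 gn]].
apply/eqP => fg0; have := dmul_lead eta fm gn.
by rewrite fg0 Defs.coef0 => /esym/eqP; rewrite mulf_eq0 (negPf fm0) (negPf gn0).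
Qed.

Lemma deg_dmul f g : deg (dmul f g) = (deg f + deg g)%E.
Proof.
have [->|f0] := eqVneq f 0.
  by rewrite dmul0l (deg_eqNy 0).2// addNye.
have [->|g0] := eqVneq g 0.
  by rewrite dmul0r (deg_eqNy 0).2// addeNy.
have [m [fm0 fm]] := is_degree_ex f0; have [n [gn0 gn]] := is_degree_ex g0.
rewrite ((degP f m).2 _)// ((degP g n).2 _)// -EFinD; apply/degP; split.
  by rewrite dmul_lead// mulf_neq0.
exact: ledeg_dmul.
Qed.

(** This is the coefficient of [T^i] in [a (b T)]. In [b T = T b + \sum_l T^l eta_l(b)], the first
    term yields [eta_i(a) b], and [a T^l eta_l(b)] yields the words of weight [i - l]. *)
Lemma dmul_mono0_swap1 (i : nonpos_int) a b :
  dmul (mono 0 a) (swap_series 1 b) (val i) = a * eta i b + eta i a * b +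
    \sum_(p \in leibniz_index (val i))
      binz L (val p.2) (size p.1) * eta_comp eta p.1 a * eta p.2 b.
Proof.
have g0 := ledeg_lseries (fun i : nonpos_int => eta i b).
rewrite swap_series1// dmulDr Defs.coefD dmul_mono rmulT_mono shiftT0 [X in X + _]/=.
rewrite swap_coef1//.
pose D := [set l : nonpos_int | val i - 1 < val l].
have Dfin : finite_set D by exact: finite_nonpos_gt.
have am := mono_filtered_dmul eta (ledeg_mono 0 a).
rewrite [X in _ + X](coef_ext _ _ am) (fsum_supp (D := val @` D)); last first.
  move=> l lD; rewrite /= rmulT_mono shiftT0.
  have [il|il] := ltP l (sval i); first by rewrite /= swap_coef_gt0 ?mul0r//; lia.
  have [l0|l0] := leP l 0; last by rewrite insubF ?mulr0// leNgt l0.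
  by case: lD; exists (exist _ l l0 : nonpos_int) => //; rewrite /D /=; lia.
rewrite fsbig_image; last by move=> p q _ _ /val_inj.
transitivity (eta i a * b + \sum_(l \in D) \sum_(s \in [set s | weight s = val i - val l])
    binz L (val l) (size s) * eta_comp eta s a * eta l b).
  congr (_ + _); apply: eq_fsbigr => l _.
  by rewrite -mulr_fsuml /= rmulT_mono shiftT0 (valK l : insub (sval l) = Some l).
rewrite fsum_sigma//; last by move=> l _; exact: finite_weight_eq.
rewrite [in RHS](addrC (a * _)) -addrA; congr (_ + _).
pose sw (p : seq nonpos_int * nonpos_int) := (p.2, p.1).
set P := (X in \sum_(p \in X) _).
(* The empty word forces [l = i] and gives [a * eta i b]; the nonempty words are those of
   [leibniz_index]. *)
have -> : P = [set (i, [::])] `|` sw @` leibniz_index (val i).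
  apply/seteqP; split=> [[l [|j s]] [/= il ls]|[l s] [[-> ->]|[[t k] [/= t0 tk] [<- <-]]]].
  - left; congr (_, _); apply: val_inj => /=; rewrite weight_nil in ls; lia.
  - by right; exists (j :: s, l) => //; split => //=; rewrite ls subrK.
  - by split; rewrite /D /= ?weight_nil; lia.
  - by split; rewrite /D /=; have := weight_le0 t; lia.
rewrite fsbigU0 ?fsbig_set1 /=.
- rewrite binz0 mul1r fsbig_image//.
  by move=> [s l] [t k] _ _ [-> ->].
- exact: finite_set1.
- exact: finite_image (finite_leibniz_index _).
- by move=> [l s] [[-> ->]] [[t k] [/= t0 _] [_ t1]]; rewrite t1 in t0.
Qed.

(** In degrees at most 0 the series identity is the Leibniz rule, coefficient by coefficient; in
    degree 1 both sides have [a * b], and above it both vanish. *)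
Lemma leibnizP : deformed_leibniz eta <->
  forall a b, swap_series 1 (a * b) = dmul (mono 0 a) (swap_series 1 b).
Proof.
split=> [leib a b|F1 i a b]; last first.
  by rewrite -dmul_mono0_swap1 -F1 -(swap_coef1 charL).
apply: laurentP => n; have [n0|n0] := leP n 0.
  have := dmul_mono0_swap1 (exist _ n n0 : nonpos_int) a b.
  by rewrite -leib => ->; rewrite -(swap_coef1 charL).
have a0 := ledeg_mono 0 a; have b1 := ledeg_swap_series eta 1 b.
have [->|n1] := eqVneq n 1.
  by have := dmul_lead eta a0 b1; rewrite add0r /= subrr !swap_coef0 => ->.
by rewrite (ledeg_dmul eta a0 b1) ?ledeg_swap_series//; lia.
Qed.

Lemma rmulT1_inj : injective (rmulT 1).
Proof.
move=> f g; rewrite !rmulTE => /eqP; rewrite -subr_eq0 -dmulBl => /eqP fg0.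
apply/eqP; rewrite -subr_eq0; apply: contraT => fg.
by have := dmul_neq0 fg (mono_neq0 1 (oner_neq0 L)); rewrite fg0 eqxx.
Qed.

Lemma rmulT_rmulT k j f : rmulT k (rmulT j f) = rmulT (j + k) f.
Proof.
elim/int_bi_ind: k j f => [j f|k IH j f|k IH j f].
- by rewrite rmulT0 addr0.
- by rewrite -rmulT1_rmulT// IH rmulT1_rmulT// addrA.
(* One more factor [T] turns both sides into the case [k + 1], and this factor can be cancelled. *)
- by apply: rmulT1_inj; rewrite !rmulT1_rmulT// IH addrA.
Qed.

(** Associativity with middle factor [T^j]; on monomials it is additivity of exponents. *)
Lemma dmul_shift j f g : dmul f (shiftT j g) = dmul (rmulT j f) g.
Proof.
have [m fm] := ledeg_ex f.
apply: (filtered_ext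
  (filtered_comp (filtered_dmulr eta fm) (filtered_shift L j))
  (filtered_dmulr eta ((filtered_rmulT eta j).2 _ _ fm))) => k b.
by rewrite shiftT_mono !dmul_mono rmulT_rmulT.
Qed.

Hypothesis leib : deformed_leibniz eta.

(** [(f b) T = f (b T)]: for [f = T^i a] this is the Leibniz rule multiplied by [T^i] on the
    left. *)
Lemma rmulT1_scale b f : rmulT 1 (scale b f) = dmul f (swap_series 1 b).
Proof.
apply: (filtered_ext
  (filtered_comp (filtered_rmulT eta 1) (filtered_scale b))
  (filtered_dmull eta (ledeg_swap_series eta 1 b))) => i a.
rewrite scale_mono rmulT_mono leibnizP.1//.
by rewrite shiftT_dmul shiftT_mono addr0.
Qed.

(** For [g = T^j b], both sides equal [(f T^j) (b T)]. *)
Lemma rmulT1_dmul f g : rmulT 1 (dmul f g) = dmul f (rmulT 1 g).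
Proof.
have [m fm] := ledeg_ex f.
apply: (filtered_ext
  (filtered_comp (filtered_rmulT eta 1) (filtered_dmulr eta fm))
  (filtered_comp (filtered_dmulr eta fm) (filtered_rmulT eta 1))) => j b.
by rewrite dmul_mono rmulT1_scale rmulT_mono dmul_shift.
Qed.

Lemma rmulT_dmul k f g : rmulT k (dmul f g) = dmul f (rmulT k g).
Proof.
elim/int_bi_ind: k => [|k IH|k IH]; first by rewrite !rmulT0.
  by rewrite -!rmulT1_rmulT// IH rmulT1_dmul.
by apply: rmulT1_inj; rewrite rmulT1_dmul !rmulT1_rmulT.
Qed.

Lemma dmulA : associative dmul.
Proof.
move=> f g h; have [m fm] := ledeg_ex f; have [n gn] := ledeg_ex g.
apply: (filtered_ext
  (filtered_comp (filtered_dmulr eta fm) (filtered_dmulr eta gn))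
  (filtered_dmulr eta (ledeg_dmul eta fm gn))) => k b.
by rewrite !dmul_mono rmulT_dmul scale_dmul.
Qed.

(** As [1] is idempotent, [1 (1 f - f) = 0], and there are no zero divisors. *)
Lemma dmul1l f : dmul (mono 0 1) f = f.
Proof.
have id1 : dmul (mono 0 1) (mono 0 1) = mono 0 1 by rewrite dmul1.
apply/eqP; rewrite -subr_eq0; apply: contraT => nz.
by have := dmul_neq0 (mono_neq0 0 (oner_neq0 L)) nz; rewrite dmulBr dmulA id1 subrr eqxx.
Qed.

End Associativity.

(** * The topology in terms of the degree filtration *)

Section Topology.
Variable L : fieldType.
Implicit Types (f g h : laurent L) (i k m n : int).

Lemma ledeg_degle k f : ledeg k f <-> (deg f <= k%:E)%E.
Proof.
have [->|f0] := eqVneq f 0; first by rewrite (deg_eqNy 0).2// leNye; split.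
have [l fl] := is_degree_ex f0; rewrite ((degP f l).2 fl) lee_fin.
case: fl => fl0 fl; split=> [fk|lk]; last exact: ledeg_le fl.
by rewrite leNgt; apply/negP => /fk /eqP; rewrite (negPf fl0).
Qed.

Lemma dist_ledeg k f g :
  laurent_dist f g < expR k%:~R <-> ledeg (k - 1) (g - f).
Proof.
by rewrite dist_lt -degN opprB deg_ltP; split=> gf i ik; apply: gf; lia.
Qed.

Lemma nbhs_laurentP f (A : set (laurent L)) :
  nbhs f A <-> exists k, forall g, ledeg k (g - f) -> A g.
Proof.
split=> [/nbhs_ballP[e /= e0 fA]|[k fA]].
  (* The floor makes the exponential at most [e]; the extra [- 1] turns the strict inequality on
     distances into a bound on the degree. *)
  exists (Num.floor (ln e) - 1) => g /dist_ledeg fg; apply: fA.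
  by apply: lt_le_trans fg _; rewrite -[leRHS](lnK e0) ler_expR floor_le.
apply/nbhs_ballP; exists (expR (k + 1)%:~R) => /=; first exact: expR_gt0.
by move=> g /dist_ledeg; rewrite addrK; exact: fA.
Qed.

(** By the ultrametric property, any finite sum of terms of degree at most [k] has degree at most
    [k], so terms outside [A] are harmless. *)
Lemma has_sumP (I : choiceType) (x : I -> laurent L) (s : laurent L) :
  (forall k, exists2 A : {fset I}, forall i : I, i \notin A -> ledeg k (x i) &
    ledeg k (s - \sum_(i <- A) x i)) -> has_sum x s.
Proof.
move=> xs U /nbhs_laurentP[k sU]; have [A xA sA] := xs k.
exists A => // B /= /fsubsetP AB; apply: sU.
have -> : summability.partial_sum x B = \sum_(i <- B) x i.
  by rewrite big_seq_fsetE.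
rewrite (bigID (mem A)) /=.
have -> : \sum_(i <- B | i \in A) x i = \sum_(i <- A) x i.
  rewrite -big_filter; apply: perm_big; apply: uniq_perm; rewrite ?filter_uniq//.
  by move=> i; rewrite mem_filter andb_idr//; exact: AB.
rewrite addrAC -opprB; apply: ledegD; first exact: ledegN.
by elim/big_rec: _ => // i f iA kf; apply: ledegD => //; exact: xA.
Qed.

Lemma laurent_add_continuous :
  continuous (fun p : laurent L * laurent L => p.1 + p.2).
Proof.
move=> [f g] U /nbhs_laurentP[k fgU].
exists ([set f' | ledeg k (f' - f)], [set g' | ledeg k (g' - g)]) => /=.
  by split; apply/nbhs_laurentP; exists k.
move=> [f' g'] [/= ff' gg']; apply: fgU.
by rewrite /= opprD addrACA; exact: ledegD.
Qed.

Lemma laurent_opp_continuous : continuous (fun f => - f).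
Proof.
move=> f U /nbhs_laurentP[k fU]; apply/nbhs_laurentP; exists k => g fg.
by apply: fU; rewrite -opprD; exact: ledegN.
Qed.

(** The filter lives on series agreeing with [c k] in degrees above [k]. Its limit therefore takes
    its coefficient in degree [n] from [c (n - 1)], and [c 0] bounds its degree. *)
Lemma laurent_complete : complete_space (laurent L).
Proof.
move=> F PF /cauchyP Fc.
have nearF k : exists f, F [set g | ledeg k (g - f)].
  have [f Ff] := Fc _ (expR_gt0 ((k + 1)%:~R)).
  by exists f; apply: filterS Ff => g /dist_ledeg; rewrite addrK.
have [c cF] := choice nearF.
have common k l : exists2 h, ledeg k (h - c k) & ledeg l (h - c l).
  by have [h [? ?]] := filter_ex (filterI (cF k) (cF l)); exists h.
have bnd : exists k, forall n, k < n -> c (n - 1) n = 0.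
  have [m cm] := ledeg_ex (c 0); exists (Num.max m 0) => n.
  rewrite gt_max => /andP[mn n0].
  have [h h0 hn] := common 0 (n - 1).
  have := h0 n n0; have := hn n; rewrite !laurent_coefB (cm n)// subr0.
  by move=> + h0n; rewrite h0n sub0r => H; apply/eqP; rewrite -oppr_eq0 H//; lia.
apply/cvg_ex; exists (Laurent bnd) => U /nbhs_laurentP[k kU].
apply: filterS (cF k) => g gk; apply: kU => n kn; rewrite laurent_coefB /=.
have [h hk hn] := common k (n - 1).
have := gk n kn; have := hk n kn; have := hn n; rewrite !laurent_coefB.
move=> H; move/eqP; rewrite subr_eq0 => /eqP e /eqP; rewrite subr_eq0 => /eqP ->.
by rewrite -e H//; lia.
Qed.

End Topology.

(** * Every deformed multiplication with the commutation rule is [dmul] *)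

Section Uniqueness.
Variable L : fieldType.
Hypothesis charL : [pchar L] =i pred0.
Variable eta : nonpos_int -> {additive L -> L}.
Variable mul : laurent L -> laurent L -> laurent L.
Hypotheses (rd : right_deformed mul) (cm : commutation eta mul).
Implicit Types (a b c : L) (f g h : laurent L) (i j k l m n : int).

Lemma rd_ledeg m n f g : ledeg m f -> ledeg n g -> ledeg (m + n) (mul f g).
Proof.
by rewrite !ledeg_degle (rd_deg rd) EFinD => *; exact: leeD.
Qed.

Lemma rd_filteredr m f : ledeg m f -> filtered m (mul f).
Proof.
move=> fm; split=> [g h|k g gk]; last by rewrite addrC; exact: rd_ledeg.
by apply/eqP; rewrite eq_sym subr_eq -(rd_mulDr rd) subrK.
Qed.

Lemma rd_filteredl m g : ledeg m g -> filtered m (mul^~ g).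
Proof.
move=> gm; split=> [f h|k f fk]; last exact: rd_ledeg.
by apply/eqP; rewrite eq_sym subr_eq -(rd_mulDl rd) subrK.
Qed.

Lemma rd_scalar f b : mul f (mono 0 b) = scale b f.
Proof.
have [m fm] := ledeg_ex f; rewrite (lseries_coef fm) (rd_scale rd).
apply: laurentP => n /=; have [nm|nm] := leP n m; first by rewrite !insubT.
by rewrite !insubF ?mul0r// leNgt nm.
Qed.

Lemma rd_mono k a : mul (mono k 1) (mono 0 a) = mono k a.
Proof. by rewrite rd_scalar scale_mono mul1r. Qed.

Lemma rd_shift k f : mul (mono k 1) f = shiftT k f.
Proof.
apply: (filtered_ext (rd_filteredr (ledeg_mono k 1)) (filtered_shift L k)) => m a.
by rewrite -(rd_mono m) (rd_mulA rd) (rd_expr rd) !rd_mono shiftT_mono.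
Qed.

(** On monomials, [(T^k a) T = T^k (a T)], and [a T] is prescribed by the commutation rule. *)
Lemma rd_rmulT1 f : mul f (mono 1 1) = rmulT eta 1 f.
Proof.
apply: (filtered_ext (rd_filteredl (ledeg_mono 1 1)) (filtered_rmulT eta 1)) => k a.
by rewrite -(rd_mono k a) -(rd_mulA rd) cm rd_shift rd_mono rmulT_mono swap_series1.
Qed.

Lemma rd_rmulT j f : mul f (mono j 1) = rmulT eta j f.
Proof.
elim/int_bi_ind: j f => [f|j IH f|j IH f]; first by rewrite rd_scalar scale1 rmulT0.
  by rewrite -rmulT1_rmulT// -IH -rd_rmulT1 -(rd_mulA rd) (rd_expr rd).
(* Negative powers: multiplying by [T] on the right leads to the exponent [j + 1], and [T]
   cancels. *)
apply: (rmulT1_inj (eta := eta)); rewrite rmulT1_rmulT// -IH -rd_rmulT1.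
by rewrite -(rd_mulA rd) (rd_expr rd).
Qed.

Lemma rd_dmul : mul = dmul eta.
Proof.
apply/funext => f; apply/funext => g; have [m fm] := ledeg_ex f.
apply: (filtered_ext (rd_filteredr fm) (filtered_dmulr eta fm)) => j b.
by rewrite dmul_mono -(rd_mono j b) (rd_mulA rd) rd_rmulT rd_scalar.
Qed.

(** Associativity of [mul] gives [(a b) T = a (b T)], which [leibnizP] translates. *)
Lemma rd_leibniz : deformed_leibniz eta.
Proof.
apply/leibnizP => // a b; rewrite -rd_dmul.
have F1 c : swap_series eta 1 c = mul (mono 0 c) (mono 1 1).
  by rewrite rd_rmulT1 rmulT_mono shiftT0.
by rewrite !F1 (rd_mulA rd) rd_scalar scale_mono.
Qed.

End Uniqueness.

(** * The deformed ring structure, inverses and continuity *)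

Section Existence.
Variable L : fieldType.
Hypothesis charL : [pchar L] =i pred0.
Variable eta : nonpos_int -> {additive L -> L}.
Hypothesis leib : deformed_leibniz eta.
Implicit Types (a b c : L) (f g h x y : laurent L) (i j k l m n : int).

Local Notation dmul := (dmul eta).

Lemma dmulB_split f g f' g' :
  dmul f g - dmul f' g' = dmul (f - f') g + dmul f' (g - g').
Proof. by rewrite dmulBl dmulBr addrA subrK. Qed.

Lemma dmul_continuous : continuous (fun p : laurent L * laurent L => dmul p.1 p.2).
Proof.
move=> [f g] U /nbhs_laurentP[k fgU].
have [m fm] := ledeg_ex f; have [n gn] := ledeg_ex g.
(* The bound [n] keeps [g'] in degree at most [n], so [(f' - f) g'] has degree at most [k]; the
   bound [k - m] does the same for [f (g' - g)]. *)
pose l := Num.min n (k - m).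
exists ([set f' | ledeg (k - n) (f' - f)], [set g' | ledeg l (g' - g)]) => /=.
  by split; apply/nbhs_laurentP; [exists (k - n)|exists l].
move=> [f' g'] [/= ff' gg']; apply: fgU => /=; rewrite dmulB_split.
have g'n : ledeg n g'.
  rewrite -(subrK g g'); apply: ledegD => //; apply: ledeg_le gg'.
  by rewrite ge_min lexx.
apply: ledegD; first by have := ledeg_dmul eta ff' g'n; rewrite subrK.
apply: ledeg_le (ledeg_dmul eta fm gg').
by rewrite -lerBrDl ge_min lexx orbT.
Qed.

Lemma dmul_right_deformed : right_deformed dmul.
Proof.
split.
- exact: dmulA.
- exact: dmulDl.
- exact: dmulDr.
- exact: dmul_continuous.
- move=> k a b; rewrite dmul_scalar; apply: laurentP => n /=.
  by case: insub => //=; rewrite mul0r.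
- move=> i j; rewrite (mono_shift i 1) -shiftT_dmul.
  by rewrite (dmul1l charL leib) shiftT_mono.
- exact: deg_dmul.
Qed.

Lemma dmul_commutation : commutation eta dmul.
Proof. by move=> a; rewrite dmul_mono scale1 rmulT_mono shiftT0 swap_series1. Qed.

Lemma dmul_rinv x : x != 0 -> exists y, dmul x y = mono 0 1.
Proof.
move=> /is_degree_ex[m [xm0 xm]].
(* [c] inverts the leading term of [x], so [x c = 1 - u] with [u] of negative degree; the geometric
   series [v] of [u] gives [x (c v) = 1]. *)
pose c := mono (- m) (x m)^-1.
have cm : ledeg (- m) c by exact: ledeg_mono.
pose u := mono 0 1 - dmul x c.
have um : ledeg (- 1) u.
  move=> n n1; rewrite laurent_coefB coef_mono.
  have [->|n0] := eqVneq n 0.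
    by rewrite -(subrr m) (dmul_lead eta xm cm) coef_mono eqxx mulfV ?subrr.
  by rewrite (ledeg_dmul eta xm cm) ?subrr//; lia.
have [v uv] := filtered_fixpoint (mono 0 1) (filtered_dmulr eta um).
by exists (dmul c v); rewrite dmulA// -[dmul x c](subKr (mono 0 1)) dmulBl dmul1l.
Qed.

(** A right inverse [y] has itself a right inverse [z], and [x = x (y z) = (x y) z = z]. *)
Lemma dmul_inv x : x != 0 ->
  exists y, dmul x y = mono 0 1 /\ dmul y x = mono 0 1.
Proof.
move=> x0; have [y xy] := dmul_rinv x0; exists y; split=> //.
have y0 : y != 0.
  apply: contraTneq (mono_neq0 0 (oner_neq0 L)) => y0.
  by rewrite -xy y0 dmul0r eqxx.
have [z yz] := dmul_rinv y0.
by rewrite -[x in dmul y x](dmul1 eta) -yz (dmulA charL leib x) xy dmul1l.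
Qed.

Lemma is_degree_inv x y d :
  is_degree x d -> dmul x y = mono 0 1 -> ledeg (- d) y.
Proof.
move=> xd xy; have : deg (dmul x y) = 0%:E.
  by rewrite xy; apply/degP; split; [rewrite coef_mono eqxx oner_neq0|exact: ledeg_mono].
rewrite deg_dmul ((degP _ _).2 xd); have [->|y0] := eqVneq y 0.
  by rewrite (deg_eqNy 0).2.
have [e ye] := is_degree_ex y0; rewrite ((degP _ _).2 ye) -EFinD => -[de].
by apply: ledeg_le ye.2; lia.
Qed.

Lemma dmul_division_ring : topological_division_ring (mono 0 1) dmul.
Proof.
split.
- exact: dmulA.
- exact: dmul1.
- exact: dmul1l.
- exact: dmulDl.
- exact: dmulDr.
- exact: (mono_neq0 0 (oner_neq0 L)).
- exact: laurent_add_continuous.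
- exact: laurent_opp_continuous.
- exact: dmul_continuous.
pose isinv x y := dmul x y = mono 0 1 /\ dmul y x = mono 0 1.
pose inv x := xget 0 [set y | isinv x y].
have invP x : x != 0 -> isinv x (inv x).
  by move=> /dmul_inv[y xy]; exact: (xgetI 0 xy).
exists inv; split=> //; apply: continuous_in_subspaceT => x /set_mem /= x0.
move=> U /nbhs_laurentP[k xU]; apply/nbhs_laurentP.
(* The bound [d - 1] gives [y] the same degree [d] as [x], so both inverses have degree at most
   [- d]. With [k + 2 d], the difference [y^-1 (x - y) x^-1] has degree at most [k]. *)
have [d xd] := is_degree_ex x0; exists (Num.min (d - 1) (k + d + d)) => y yx.
have yxd : ledeg (d - 1) (y - x) by apply: ledeg_le yx; rewrite ge_min lexx.
have yd : is_degree y d.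
  split=> [|i di]; last by rewrite -(subrK x y) Defs.coefD yxd ?xd.2 ?addr0//; lia.
  by rewrite -(subrK x y) Defs.coefD yxd ?add0r ?xd.1//; lia.
have y0 : y != 0 by apply: contraNneq yd.1 => ->; rewrite Defs.coef0.
apply: xU => /=; have [xx' x'x] := invP x x0; have [yy' y'y] := invP y y0.
have -> : inv y - inv x = dmul (dmul (inv y) (x - y)) (inv x).
  by rewrite dmulBr y'y dmulBl dmul1l// -dmulA// xx' dmul1.
have x'd := is_degree_inv xd xx'; have y'd := is_degree_inv yd yy'.
have xyk : ledeg (k + d + d) (x - y).
  by rewrite -opprB; apply: ledegN; apply: ledeg_le yx; rewrite ge_min lexx orbT.
by apply: ledeg_le (ledeg_dmul eta (ledeg_dmul eta y'd xyk) x'd); lia.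
Qed.

End Existence.

(** * The center and the field of constants *)

Section Center.
Variable L : fieldType.
Hypothesis charL : [pchar L] =i pred0.
Variable eta : nonpos_int -> {additive L -> L}.
Implicit Types (a b c : L) (f g h x y z : laurent L) (j k l m n d : int).
Implicit Types (i : nonpos_int) (s : seq nonpos_int).

Local Notation dmul := (dmul eta).

Lemma constantsP c :
  constants eta c <-> dmul (mono 0 c) (mono 1 1) = mono 1 c.
Proof.
rewrite dmul_mono scale1 rmulT_mono shiftT0 swap_series1//.
split=> [c0|/(congr1 (fun f => f - mono 1 c))].
  rewrite -[RHS]addr0; congr (_ + _); apply: laurentP => n /=.
  by case: insub => //= i; rewrite c0.
rewrite addrC addKr subrr => c0 i.
have := coef_lseries (fun i => eta i c) (valP i).
by rewrite c0 Defs.coef0 => ->; congr (eta _ c); exact: val_inj.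
Qed.

Lemma swap_series_constant j c : constants eta c -> swap_series eta j c = mono j c.
Proof.
move=> c0; have etas0 s : (0 < size s)%N -> eta_comp eta s c = 0.
  elim: s => // i [_ _|i' s IH _]; first exact: c0.
  by rewrite eta_comp_cons IH// raddf0.
apply: laurentP => n; rewrite coef_mono /= -subr_eq0.
have [->|nj] := eqVneq (n - j) 0; first exact: swap_coef0.
apply: fsbig1 => s /= sn; rewrite etas0 ?mulr0//.
by case: s sn => // sn; rewrite -sn weight_nil eqxx in nj.
Qed.

Lemma dmul_constant c f : constants eta c -> dmul (mono 0 c) f = scale c f.
Proof.
move=> c0.
apply: (filtered_ext (filtered_dmulr eta (ledeg_mono 0 c)) (filtered_scale c)) => j b.
by rewrite dmul_mono rmulT_mono shiftT0 swap_series_constant// !scale_mono mulrC.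
Qed.

(** Indices are at most 0, so a top one is obtained by minimizing the natural number [- i]. *)
Lemma top_eta : (exists i a, eta i a != 0) ->
  exists i, (exists a, eta i a != 0) /\ forall i', val i < val i' -> forall a, eta i' a = 0.
Proof.
move=> [i0 [a0 ia0]].
pose P (n : nat) := `[< exists i a, val i = - n%:Z /\ eta i a != 0 >].
have exP : exists n : nat, P n.
  exists `|val i0|%N; apply/asboolP; exists i0, a0; split=> //.
  by have /= := valP i0; lia.
case: (ex_minnP exP) => n /asboolP[i [a [ni ia]]] min; exists i; split; first by exists a.
move=> i' ii' b; apply: contrapT => /eqP ib; have /= i'0 := valP i'.
have : P `|val i'|%N.
  by apply/asboolP; exists i', b; split=> //=; lia.
by move=> /min; move: ii'; rewrite ni /=; lia.
Qed.

Section TopEta.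
Variable i0 : nonpos_int.
Hypothesis i0_top : forall i, val i0 < val i -> forall a, eta i a = 0.

(** Letters above [i0] act as zero, so each letter of a word not killing [a] contributes at most
    [i0 - 1]. *)
Lemma weight_top s a : eta_comp eta s a != 0 -> weight s <= (val i0 - 1) *+ size s.
Proof.
elim: s => [|i s IH]; first by rewrite weight_nil.
rewrite eta_comp_cons weight_cons mulrS => ia; apply: lerD.
  rewrite lerD2r leNgt; apply/negP => /i0_top i0a.
  by rewrite i0a eqxx in ia.
by apply: IH; apply: contraNneq ia => ->; rewrite raddf0.
Qed.

Lemma swap_coef_between j d a : val i0 - 1 < d -> d < 0 -> swap_coef eta j d a = 0.
Proof.
move=> i0d d0; apply: fsbig1 => s /= sd.
have [->|/weight_top] := eqVneq (eta_comp eta s a) 0; first by rewrite mulr0.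
case: s sd => [|i s]; first by rewrite weight_nil => d00; rewrite -d00 ltxx in d0.
move=> -> dle; have i00 : val i0 <= 0 := valP i0.
have : (val i0 - 1) *+ size s <= 0 by rewrite mulrn_wle0//; lia.
by move: dle; rewrite [size _]/= mulrS; lia.
Qed.

(** Words with at least two letters that do not kill [a] weigh at most [2 (i0 - 1) < i0 - 1]. Only
    [[:: i0]] remains, with binomial coefficient [j]. *)
Lemma swap_coef_top j a : swap_coef eta j (val i0 - 1) a = j%:~R * eta i0 a.
Proof.
rewrite /swap_coef -(fsbig_widen [set [:: i0]]) ?fsbig_set1.
- by rewrite binz1.
- by move=> s -> /=; rewrite weight_cons weight_nil addr0.
move=> s [si0 sNi0]; have {}si0 : weight s = val i0 - 1 := si0.
suff : binz L j (size s) * eta_comp eta s a = 0 by [].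
have [->|/weight_top] := eqVneq (eta_comp eta s a) 0; first by rewrite mulr0.
have i00 : val i0 <= 0 := valP i0.
rewrite si0; case: s si0 sNi0 => [|i [|i' s]] si0 sNi0.
- by rewrite weight_nil in si0; lia.
- case: sNi0; congr [:: _]; apply: val_inj.
  by move: si0; rewrite weight_cons weight_nil; lia.
have : (val i0 - 1) *+ size s <= 0 by rewrite mulrn_wle0//; lia.
by rewrite [size _]/= !mulrS; lia.
Qed.

(** Only the leading term of [a T^n] and the first correction of [a T^m] reach degree [n]; for
    exponents strictly between, [swap_coef_between] applies. *)
Lemma coef_dmul_mono0_top a z m : ledeg m z ->
  dmul (mono 0 a) z (m + (val i0 - 1)) =
  a * z (m + (val i0 - 1)) + m%:~R * eta i0 a * z m.
Proof.
move=> zm; pose n := m + (val i0 - 1); rewrite -/n.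
have nm : n < m by have /= := valP i0; rewrite /n /=; lia.
have am := mono_filtered_dmul eta (ledeg_mono 0 a).
rewrite (coef_ext _ _ am) (fsum_supp (D := [set n] `|` [set m])); last first.
  move=> k /not_orP[/= kn km]; rewrite rmulT_mono shiftT0 /=.
  have [mk|mk] := ltP m k; first by rewrite zm ?mulr0.
  have [kn'|kn'] := ltP k n; first by rewrite swap_coef_gt0 ?mul0r ?subr_gt0.
  by rewrite swap_coef_between ?mul0r// /n /=; rewrite /n /= in kn kn'; lia.
rewrite fsbigU0 ?fsbig_set1; [|exact: finite_set1|exact: finite_set1|]; last first.
  by move=> k [/= -> nm']; rewrite nm' ltxx in nm.
rewrite /= !rmulT_mono !shiftT0 /= subrr swap_coef0; congr (_ + _ * _).
by rewrite -swap_coef_top; congr swap_coef; rewrite /n addrAC subrr add0r.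
Qed.

End TopEta.

Hypothesis eta_neq0 : exists i a, eta i a != 0.

(* A series commuting with [L] has degree 0: the coefficient of [a z - z a] in
   degree [m + j - 1], for [j] the top index with [eta_j <> 0], is
   [m eta_j(a) z_m]. *)
Lemma degree_commute_scalars z m : (forall a, dmul z (mono 0 a) = dmul (mono 0 a) z) ->
  is_degree z m -> m = 0.
Proof.
move=> za [zm0 zm]; have [i [[a ia] itop]] := top_eta eta_neq0.
have := coef_dmul_mono0_top itop a zm.
rewrite -za dmul_scalar /= mulrC => /eqP.
rewrite -subr_eq0 opprD addrA subrr sub0r oppr_eq0 !mulf_eq0 (negPf ia) (negPf zm0).
by rewrite !orbF intr_eq0_char0// => /eqP.
Qed.

(** For central [z] with constant term [c], the series [z - c] commutes with [L]; were it nonzero,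
    its degree would be 0, where its coefficient vanishes. Commuting with [T] then makes [c] a
    constant. *)
Lemma center_dmul : ring_center dmul = mono 0 @` constants eta.
Proof.
apply/seteqP; split=> [z zC|_ [c c0 <-] x]; last first.
  by rewrite dmul_constant// dmul_scalar.
pose c := z 0; have zE : z = mono 0 c.
  apply/eqP; rewrite -subr_eq0; apply: contraT => w0.
  have [m wm] := is_degree_ex w0.
  have m0 : m = 0.
    apply: degree_commute_scalars wm => a.
    by rewrite dmulBl dmulBr zC !dmul_scalar !scale_mono mulrC.
  by have := wm.1; rewrite m0 laurent_coefB coef_mono eqxx subrr eqxx.
exists c => //; apply/constantsP.
by rewrite -zE zC zE dmul_scalar scale_mono mul1r.
Qed.

Hypothesis leib : deformed_leibniz eta.

Lemma constantsB a b : constants eta a -> constants eta b -> constants eta (a - b).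
Proof. by move=> a0 b0 i; rewrite raddfB a0 b0 subrr. Qed.

Lemma constants1 : constants eta 1.
Proof. by apply/constantsP; rewrite dmul1l. Qed.

Lemma constantsM a b : constants eta a -> constants eta b -> constants eta (a * b).
Proof.
move=> a0 b0; apply/constantsP.
rewrite -scale_mono -(dmul_scalar eta) -dmulA// dmul_constant// (constantsP b).1//.
by rewrite scale_mono mulrC.
Qed.

(** Left and right multiplication by the constant [a] agree, so
    [a^-1 T = (a (a^-1 T)) a^-1 = T a^-1]. *)
Lemma constantsV a : constants eta a -> constants eta a^-1.
Proof.
move=> a0; have [->|an0] := eqVneq a 0; first by rewrite invr0 => i; exact: raddf0.
apply/constantsP; rewrite -[LHS]scale1 -[X in scale X _](mulfV an0) -scale_scale.
rewrite -(dmul_constant _ a0) dmulA// [dmul (mono 0 a) _]dmul_constant// scale_mono.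
by rewrite mulVf// dmul1l// scale_mono mul1r.
Qed.

Lemma divring_closed_constants : divring_closed (mem (constants eta)).
Proof.
split.
- exact/mem_set/constants1.
- by move=> a b /set_mem a0 /set_mem b0; exact/mem_set/constantsB.
- by move=> a b /set_mem a0 /set_mem b0; apply/mem_set/constantsM => //; exact: constantsV.
Qed.

End Center.

(** * Convergence of the explicit product formulas *)

Section Sums.
Variable L : fieldType.
Hypothesis charL : [pchar L] =i pred0.
Variable eta : nonpos_int -> {additive L -> L}.
Implicit Types (j k l m n d : int).

Lemma finite_below_gt m l : finite_set [set i : below m | l < val i].
Proof.
apply: (@sub_finite_set _ _ (val @^-1` [set i : int | l <= i <= m])).
  by move=> i /= li; rewrite ltW//=; exact: (valP i).
by apply: finite_preimage (finite_int_itv l m) => p q _ _; exact: val_inj.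
Qed.

Lemma coef_fsum (I : choiceType) (A : set I) (x : I -> laurent L) n :
  finite_set A -> (\sum_(i \in A) x i) n = \sum_(i \in A) x i n.
Proof. by move=> Afin; rewrite !fsbig_finite// laurent_coef_sum. Qed.

Lemma ledeg_lseries_tail m (a : below m -> L) l :
  ledeg l (lseries a - \sum_(i \in [set i : below m | l < val i]) mono (val i) (a i)).
Proof.
move=> n ln; rewrite laurent_coefB coef_fsum; last exact: finite_below_gt.
have [nm|mn] := leP n m; last first.
  rewrite ledeg_lseries// fsbig1 ?subrr// => i _; rewrite coef_mono.
  by case: eqP => // ni; have /= := valP i; move: mn; rewrite ni /= ltNge => /negP.
rewrite coef_lseries -(fsbig_widen [set exist _ n nm : below m]).
- by rewrite fsbig_set1 coef_mono eqxx subrr.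
- by move=> _ ->.
move=> i [_ ni] /=; case: eqP => // nE; case: ni; exact: val_inj.
Qed.

Lemma has_sum_dmul m n (a : below m -> L) (b : below n -> L) :
  has_sum (fun p : below m * below n =>
      dmul eta (mono (val p.1) (a p.1)) (mono (val p.2) (b p.2)))
    (dmul eta (lseries a) (lseries b)).
Proof.
apply: has_sumP => k.
(* The other factors have degrees at most [n] and [m], so a pair outside [X] times [Y] contributes
   only in degrees at most [k]. *)
pose X := [set i : below m | k - n < val i].
pose Y := [set i : below n | k - m < val i].
have Xfin : finite_set X by exact: finite_below_gt.
have Yfin : finite_set Y by exact: finite_below_gt.
exists (fset_set (X `*` Y)).
  move=> [p q]; rewrite in_fset_set; last exact: finite_setX.
  move=> /negP pq.
  have := ledeg_dmul eta (ledeg_mono (val p) (a p)) (ledeg_mono (val q) (b q)).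
  apply: ledeg_le; rewrite leNgt; apply/negP => kpq; apply: pq; apply/mem_set.
  have pm : val p <= m := valP p; have qn : val q <= n := valP q.
  have kp : k - n < val p by lia.
  have kq : k - m < val q by lia.
  by split.
rewrite -fsbig_finite; last exact: finite_setX.
rewrite -(pair_fsbig _ (fun p q => dmul eta (mono (val p) (a p)) (mono (val q) (b q))))//.
pose f1 := \sum_(i \in X) mono (val i) (a i).
pose g1 := \sum_(i \in Y) mono (val i) (b i).
have f1m : ledeg m f1.
  move=> j mj; rewrite coef_fsum// fsbig1// => i _; rewrite coef_mono.
  have im : val i <= m := valP i.
  by case: eqP => // ij; move: mj; rewrite ij ltNge im.
have -> : \sum_(p \in X) \sum_(q \in Y)
    dmul eta (mono (val p) (a p)) (mono (val q) (b q)) = dmul eta f1 g1.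
  have [r g1r] := ledeg_ex g1.
  rewrite /f1 fsbig_finite// [in RHS]fsbig_finite//.
  rewrite (filtered_sum _ _ (filtered_dmull eta g1r)); apply: eq_bigr => i _.
  rewrite /g1 !fsbig_finite//.
  by rewrite (filtered_sum _ _ (filtered_dmulr eta (ledeg_mono _ _))).
(* The truncation error is [(f - f1) g + f1 (g - g1)] for the full series [f] and [g]; the cutoffs
   put both terms in degree at most [k]. *)
rewrite dmulB_split; apply: ledegD.
  have := ledeg_dmul eta (ledeg_lseries_tail a (l := k - n)) (ledeg_lseries b).
  by rewrite subrK.
have := ledeg_dmul eta f1m (ledeg_lseries_tail b (l := k - m)).
by rewrite addrC subrK.
Qed.

Lemma swap_coef_split j d (a : L) : swap_coef eta j d a = (if d == 0 then a else 0) +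
  \sum_(s \in [set s | (0 < size s)%N /\ weight s = d])
    binz L j (size s) * eta_comp eta s a.
Proof.
have [->|d0] := eqVneq d 0.
  rewrite swap_coef0 fsbig1 ?addr0// => s [/weight_lt0 + s0].
  by rewrite s0 ltxx.
rewrite add0r /swap_coef; apply: eq_fsbigl; apply/seteqP; split=> [s|s []//] /= sd.
by split=> //; case: s sd => // sd; rewrite -sd weight_nil eqxx in d0.
Qed.

Lemma has_sum_mono i j (a b : L) :
  has_sum (fun s : {s : seq nonpos_int | (0 < size s)%N} =>
      mono (weight (val s) + i + j) (binz L j (size (val s)) * eta_comp eta (val s) a * b))
    (dmul eta (mono i a) (mono j b) - mono (i + j) (a * b)).
Proof.
apply: has_sumP => k.
pose A := [set s : {s : seq nonpos_int | (0 < size s)%N} | k < weight (val s) + i + j].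
have Afin : finite_set A.
  apply: (@sub_finite_set _ _
      (val @^-1` [set s | - `|(k - i - j)%R|%N%:Z <= weight s])).
    by move=> s; rewrite /A /=; lia.
  by apply: finite_preimage (finite_weight_ge _) => p q _ _; exact: val_inj.
exists (fset_set A).
  move=> s; rewrite in_fset_set// => /negP sA.
  apply: ledeg_le (ledeg_mono _ _); rewrite leNgt; apply/negP => ks.
  by apply: sA; exact/mem_set.
rewrite -fsbig_finite// => n kn.
rewrite !laurent_coefB coef_fsum// dmul_mono rmulT_mono /= swap_coef_split mulrDl.
set d := n - i - j.
have -> : (if n == i + j then a * b else 0) = (if d == 0 then a else 0) * b.
  have -> : (n == i + j) = (d == 0) by rewrite /d; lia.
  by case: eqP; rewrite ?mul0r.
rewrite [_ + _ * b]addrC addrK mulr_fsuml; apply/eqP; rewrite subr_eq0; apply/eqP.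
(* In degree [n] only the words of weight [d] contribute, and [k < n] places them all in [A]. *)
pose D := [set s : {s : seq nonpos_int | (0 < size s)%N} | weight (val s) = d].
have -> : [set s | (0 < size s)%N /\ weight s = d] = val @` D.
  apply/seteqP; split=> [s [s0 sd]|_ [s sd <-]]; first by exists (exist _ s s0).
  by split=> //; exact: (valP s).
rewrite fsbig_image; last by move=> s t _ _ /val_inj.
transitivity (\sum_(s \in D) mono (weight (val s) + i + j)
    (binz L j (size (val s)) * eta_comp eta (val s) a * b) n).
  apply: eq_fsbigr => s /set_mem sd.
  by rewrite coef_mono sd /d (_ : n - i - j + i + j = n) ?eqxx//; lia.
apply: fsbig_widen => [s sd|s [_ sd]]; first by rewrite /A /= sd /d; lia.
rewrite /= ifF//; apply/negP => /eqP nE; apply: sd.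
have {}nE : n = weight (val s) + i + j := nE.
suff : weight (val s) = d by [].
by rewrite /d nE; lia.
Qed.

End Sums.

Theorem corollary3p12 (L : fieldType) (charL : [pchar L] =i pred0)
    (eta : nonpos_int -> {additive L -> L})
    (eta_neq0 : exists (i : nonpos_int) (a : L), eta i a != 0) :
  ((exists! mul : laurent L -> laurent L -> laurent L,
      right_deformed mul /\ commutation eta mul)
   <-> deformed_leibniz eta)
  /\
  (deformed_leibniz eta ->
   forall mul : laurent L -> laurent L -> laurent L,
   right_deformed mul -> commutation eta mul ->
   [/\ forall (m n : int) (a : below m -> L) (b : below n -> L),
         has_sum (fun p : below m * below n =>
                    mul (mono (val p.1) (a p.1)) (mono (val p.2) (b p.2)))
                 (mul (lseries a) (lseries b)),
       forall (i j : int) (a b : L),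
         exists2 S : laurent L,
           has_sum (fun s : {s : seq nonpos_int | (0 < size s)%N} =>
                      mono (weight (val s) + i + j)
                        (binz L j (size (val s)) * eta_comp eta (val s) a * b))
                   S
           & mul (mono i a) (mono j b) = mono (i + j) (a * b) + S,
       topological_division_ring (mono 0 1) mul,
       complete_space (laurent L)
     & divring_closed (mem (constants eta)) /\
       ring_center mul = mono 0 @` constants eta]).
Proof.
split; first split=> [[mul [[rd cm] _]]|leib].
- exact: rd_leibniz rd cm.
- exists (dmul eta); split.
    by split; [exact: dmul_right_deformed|exact: dmul_commutation].
  by move=> mul [rd cm]; exact/esym/rd_dmul.
(* Uniqueness reduces every claim about [mul] to [dmul eta]. *)
move=> leib mul rd cm; rewrite (rd_dmul charL rd cm); split.
- exact: has_sum_dmul.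
- move=> i j a b; exists (dmul eta (mono i a) (mono j b) - mono (i + j) (a * b)).
    exact: has_sum_mono.
  by rewrite addrC subrK.
- exact: dmul_division_ring.
- exact: laurent_complete.
- by split; [exact: divring_closed_constants|exact: center_dmul].
Qed.
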